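(* Let $h>0$, $0<\alpha\le0.1$, $0<\lambda_v,\lambda_h<1$. Consider the perturbed square camera grid $\widehat{\mathcal S}=\{\hat s_{ij}=(ih+a_{ij},\,jh+b_{ij},\,h+c_{ij}): i,j\in\mathbb Z\}$ of resolution $\delta_d=h$, where the horizontal perturbations satisfy $|a_{ij}|,|b_{ij}|\le\lambda_h h$ and the vertical perturbations satisfy $|c_{ij}|\le\lambda_v h$. For every target $g\in\mathcal G$, $$\overline\varepsilon(g)=\min_{\hat s,\hat s'\in\widehat{\mathcal S}}\varepsilon(g,\{\hat s,\hat s'\})\;\le\;2.47\,\frac{1+\lambda_v}{1-\lambda_h}\,\varepsilon(g,\mathcal S).$$
   Context: Work in $\mathbb{R}^3$ with coordinates $(x,y,z)$. The ground plane is $\mathcal G=\{z=0\}$ and the (unperturbed) viewing plane is $\mathcal S=\{z=h\}$. For a point $s$ and unit vector $u$, the cone $K(s,u)=\{s+rv:\ r\ge0,\ |v|=1,\ \angle(v,u)\le\alpha\}$ (apex $s$, half-angle $\alpha$). For target $g$ and camera $s$, $\mathcal K(g,s)$ is the set of all cones $K(s,u)$ containing $g$. For any set $C$ of camera locations, $\varepsilon(g,C)=\sup\{\operatorname{diam}(\bigcap_{s\in C}K_s): K_s\in\mathcal K(g,s)\ \forall s\in C\}$. *)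

(* Defs.v *)
From Stdlib Require Import Reals Lra.
Open Scope R_scope.

Record pt := Pt { px : R; py : R; pz : R }.

Definition padd (p q : pt) : pt := Pt (px p + px q) (py p + py q) (pz p + pz q).
Definition psub (p q : pt) : pt := Pt (px p - px q) (py p - py q) (pz p - pz q).
Definition pscale (r : R) (p : pt) : pt := Pt (r * px p) (r * py p) (r * pz p).
Definition dot (p q : pt) : R := px p * px q + py p * py q + pz p * pz q.
Definition norm (p : pt) : R := sqrt (dot p p).
Definition dist (p q : pt) : R := norm (psub p q).

Definition angle (v u : pt) : R := acos (dot v u).

Definition in_cone (alpha : R) (s u p : pt) : Prop :=
  exists r v, 0 <= r /\ norm v = 1 /\ angle v u <= alpha /\ p = padd s (pscale r v).

(* "eps(g, C) <= t": for every choice of cones K_s in K(g,s) (s in C),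
   i.e. unit axes U s with g in K(s, U s), every two points of the
   intersection of the K_s are at distance <= t  (i.e. diam <= t).
   Since eps(g,C) is a supremum of diameters (possibly +infinity),
   eps(g,C) <= t  iff  eps_le alpha g C t. *)
Definition eps_le (alpha : R) (g : pt) (C : pt -> Prop) (t : R) : Prop :=
  forall U : pt -> pt,
    (forall s, C s -> norm (U s) = 1 /\ in_cone alpha s (U s) g) ->
    forall p q,
      (forall s, C s -> in_cone alpha s (U s) p) ->
      (forall s, C s -> in_cone alpha s (U s) q) ->
      dist p q <= t.

Definition plane (h : R) : pt -> Prop := fun p => pz p = h.

Definition cam (h : R) (a b c : Z -> Z -> R) (i j : Z) : pt :=
  Pt (IZR i * h + a i j) (IZR j * h + b i j) (h + c i j).

(* Main.v *)
Require Import Defs.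
From Stdlib Require Import Reals.
From Stdlib Require Import Lra Lia Psatz ZArith List Bool.
Open Scope R_scope.

(** With [s2 = sin (2 * alpha)], the segment of length [2 h s2 / (1 - s2)] hanging vertically
    from the target is seen under an angle of at most [2 alpha] from every point of the plane,
    which bounds the optimal uncertainty from below.

    Conversely, let two cameras at distance at most [d] see the target along lines whose angle
    has a half with sine [sig]. Any vector makes an angle of sine at least [sig] with one of
    the two lines. Applied to the vector from the target to a common point of the cones this
    confines the intersection to a ball of radius [s2 d / (sig - 1/5)], and applied to a chord
    [pq] of the intersection it gives
    [sig |pq| <= 2 sin alpha (d + s2 d / (sig - 1/5))].

    The theorem therefore follows once two cameras of the perturbed grid satisfy
    [(1 - lh) d <= 6 (sig - 1/5) (1 + lv) h]. Which two depends on the position of the target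
    in its grid cell, on [lh], [lv] and on the perturbations; the choice is made by a finite
    decision tree, each leaf of which is validated by bilinear inequalities at the corners of
    boxes. *)

(** * Cones and chords *)

(** The lower bound is essentially [2 h s2], the upper one a multiple of [sin alpha], and
    [s2 = 2 sin alpha cos alpha], so [sin alpha] cancels and the geometry of the two cameras
    remains. The slack [sig - 1/5] is a linear lower bound for the sine of the half angle diminished
    by [2 alpha]. Since the admissible distance is a multiple of that same slack, it cancels against
    the radius of the ball and leaves [6 (sig - 1/5 + s2) (1 - s2) <= 4.94 cos alpha sig], where
    4.94 is twice 2.47 and 6 is a round value that this allows. The obstacle is the choice of
    cameras. The perturbations are adversarial and may reach almost a full cell, while the distance
    budget grows like [(1 + lv) / (1 - lh)]. For small [lh] the pair has to react to the actual
    positions; for [lh] near 1 remote cameras become affordable, whose directions a perturbation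
    turns only a little. The angle condition contains a product of norms; a bilinear lower bound for
    it leaves functions affine in each coordinate, which integer arithmetic can test at corners. *)

Ltac vring := unfold dot, psub, padd, pscale; simpl; ring.

Lemma dot_self_nonneg (p : pt) : 0 <= dot p p.
Proof. unfold dot; nra. Qed.

Lemma norm_nonneg (p : pt) : 0 <= norm p.
Proof. apply sqrt_pos. Qed.

Lemma norm_sqr (p : pt) : norm p * norm p = dot p p.
Proof. apply sqrt_sqrt, dot_self_nonneg. Qed.

Lemma dot_sqr_le (p q : pt) : dot p q * dot p q <= dot p p * dot q q.
Proof.
  assert (dot p p * dot q q - dot p q * dot p q
    = Rsqr (px p * py q - py p * px q) + Rsqr (py p * pz q - pz p * py q)
      + Rsqr (pz p * px q - px p * pz q)) by (unfold dot, Rsqr; ring).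
  pose proof (Rle_0_sqr (px p * py q - py p * px q)).
  pose proof (Rle_0_sqr (py p * pz q - pz p * py q)).
  pose proof (Rle_0_sqr (pz p * px q - px p * pz q)).
  lra.
Qed.

Lemma sqr_le_le (x y : R) : 0 <= y -> x * x <= y * y -> x <= y.
Proof. intros Hy H; destruct (Rle_dec x y); nra. Qed.

Lemma sqr_le_abs_le (x y : R) : 0 <= y -> x * x <= y * y -> Rabs x <= y.
Proof.
  intros Hy H; apply sqr_le_le; trivial.
  unfold Rabs; destruct (Rcase_abs x); lra.
Qed.

Lemma dot_abs_le (p q : pt) : Rabs (dot p q) <= norm p * norm q.
Proof.
  pose proof (norm_nonneg p); pose proof (norm_nonneg q).
  apply sqr_le_abs_le; [now apply Rmult_le_pos|].
  replace (norm p * norm q * (norm p * norm q))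
    with ((norm p * norm p) * (norm q * norm q)) by ring.
  rewrite !norm_sqr; apply dot_sqr_le.
Qed.

Lemma dot_le (p q : pt) : dot p q <= norm p * norm q.
Proof. eapply Rle_trans; [apply Rle_abs | apply dot_abs_le]. Qed.

Lemma norm_scale (r : R) (p : pt) : 0 <= r -> norm (pscale r p) = r * norm p.
Proof.
  intros Hr; unfold norm.
  replace (dot (pscale r p) (pscale r p)) with ((r * r) * dot p p) by vring.
  rewrite sqrt_mult, sqrt_square; trivial; [nra | apply dot_self_nonneg].
Qed.

Lemma norm_sub_le (p q : pt) : norm (psub p q) <= norm p + norm q.
Proof.
  pose proof (norm_nonneg p); pose proof (norm_nonneg q).
  apply sqr_le_le; [lra|].
  rewrite norm_sqr.
  replace (dot (psub p q) (psub p q)) with (dot p p - 2 * dot p q + dot q q) by vring.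
  rewrite <- !norm_sqr.
  pose proof (dot_abs_le p q) as Hd.
  unfold Rabs in Hd; destruct (Rcase_abs (dot p q)); nra.
Qed.

Lemma cos_le_of_acos_le (x alpha : R) :
  -1 <= x <= 1 -> alpha <= PI -> acos x <= alpha -> cos alpha <= x.
Proof.
  intros Hx Ha H; rewrite <- (cos_acos x Hx).
  pose proof (acos_bound x); apply cos_decr_1; lra.
Qed.

Lemma acos_le_of_cos_le (x alpha : R) :
  -1 <= x <= 1 -> 0 <= alpha <= PI -> cos alpha <= x -> acos x <= alpha.
Proof.
  intros Hx Ha H; pose proof (acos_bound x).
  apply cos_decr_0; try lra; now rewrite cos_acos.
Qed.

Lemma dot_units_bound (u v : pt) : norm u = 1 -> norm v = 1 -> -1 <= dot u v <= 1.
Proof.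
  intros Hu Hv; pose proof (dot_abs_le u v) as H; rewrite Hu, Hv in H.
  unfold Rabs in H; destruct (Rcase_abs (dot u v)); lra.
Qed.

(** Cones are handled through this inequality from here on: it involves neither [acos] nor a
    normalised direction, and it stays meaningful at the apex, where both sides vanish. *)
Lemma in_cone_cos (alpha : R) (s u p : pt) :
  alpha <= PI -> norm u = 1 -> in_cone alpha s u p ->
  cos alpha * norm (psub p s) <= dot (psub p s) u.
Proof.
  intros Ha Hu (r & v & Hr & Hv & Hang & ->).
  assert (Hvu : cos alpha <= dot v u)
    by (apply cos_le_of_acos_le; trivial; now apply dot_units_bound).
  replace (psub (padd s (pscale r v)) s) with (pscale r v)
    by (unfold psub, padd, pscale; simpl; f_equal; ring).
  rewrite norm_scale, Hv by trivial.
  replace (dot (pscale r v) u) with (r * dot v u) by vring.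
  nra.
Qed.

Lemma in_cone_intro (alpha : R) (s u p : pt) :
  0 <= alpha <= PI -> norm u = 1 -> 0 < norm (psub p s) ->
  cos alpha * norm (psub p s) <= dot (psub p s) u ->
  in_cone alpha s u p.
Proof.
  intros Ha Hu Hp H; set (r := norm (psub p s)) in *.
  assert (Hi : 0 < / r) by now apply Rinv_0_lt_compat.
  assert (Hri : / r * r = 1) by (apply Rinv_l; lra).
  assert (Hv : norm (pscale (/ r) (psub p s)) = 1)
    by (rewrite norm_scale by lra; exact Hri).
  exists r, (pscale (/ r) (psub p s)); repeat split; trivial.
  - lra.
  - unfold angle; apply acos_le_of_cos_le; trivial; [now apply dot_units_bound|].
    replace (dot (pscale (/ r) (psub p s)) u) with (/ r * dot (psub p s) u) by vring.
    replace (cos alpha) with (/ r * (cos alpha * r)) by (field; lra).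
    apply Rmult_le_compat_l; lra.
  - destruct p, s; unfold padd, pscale, psub; simpl; f_equal; field; lra.
Qed.

Lemma orth_part_sqr (x u : pt) : norm u = 1 ->
  dot (psub x (pscale (dot x u) u)) (psub x (pscale (dot x u) u))
  = dot x x - dot x u * dot x u.
Proof.
  intros Hu.
  replace (dot (psub x (pscale (dot x u) u)) (psub x (pscale (dot x u) u)))
    with (dot x x - 2 * (dot x u * dot x u) + dot x u * dot x u * dot u u) by vring.
  rewrite <- (norm_sqr u), Hu; ring.
Qed.

Lemma orth_part_le (alpha : R) (x u : pt) :
  norm u = 1 -> 0 <= sin alpha -> 0 <= cos alpha -> cos alpha * norm x <= dot x u ->
  norm (psub x (pscale (dot x u) u)) <= sin alpha * norm x.
Proof.
  intros Hu Hs Hc H; pose proof (norm_nonneg x).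
  apply sqr_le_le; [now apply Rmult_le_pos|].
  rewrite norm_sqr, orth_part_sqr, <- norm_sqr by trivial.
  pose proof (sin2_cos2 alpha) as E; unfold Rsqr in E.
  assert (0 <= cos alpha * norm x) by now apply Rmult_le_pos.
  assert (cos alpha * norm x * (cos alpha * norm x) <= dot x u * dot x u) by nra.
  replace (sin alpha * norm x * (sin alpha * norm x))
    with ((sin alpha * sin alpha) * (norm x * norm x)) by ring.
  replace (sin alpha * sin alpha) with (1 - cos alpha * cos alpha) by lra.
  nra.
Qed.

(** Triangle inequality for angles at the apex, by splitting off the axis: the axial parts
    contribute at least [cos alpha * cos alpha], the orthogonal parts at least
    [- sin alpha * sin alpha], relative to the product of the norms. *)
Lemma cone_pair_angle (alpha : R) (x y u : pt) :
  norm u = 1 -> 0 <= sin alpha -> 0 <= cos alpha ->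
  cos alpha * norm x <= dot x u -> cos alpha * norm y <= dot y u ->
  cos (2 * alpha) * (norm x * norm y) <= dot x y.
Proof.
  intros Hu Hs Hc Hx Hy.
  pose proof (orth_part_le alpha x u Hu Hs Hc Hx) as Ox.
  pose proof (orth_part_le alpha y u Hu Hs Hc Hy) as Oy.
  set (xo := psub x (pscale (dot x u) u)) in *.
  set (yo := psub y (pscale (dot y u) u)) in *.
  assert (E : dot x y = dot x u * dot y u + dot xo yo).
  { assert (dot xo yo = dot x y - dot x u * dot y u * (2 - dot u u))
      by (unfold xo, yo; vring).
    rewrite <- (norm_sqr u), Hu in H; lra. }
  pose proof (dot_abs_le xo yo) as Hd.
  pose proof (norm_nonneg xo); pose proof (norm_nonneg yo).
  pose proof (norm_nonneg x); pose proof (norm_nonneg y).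
  assert (norm xo * norm yo <= sin alpha * norm x * (sin alpha * norm y))
    by (apply Rmult_le_compat; trivial).
  assert (cos alpha * norm x * (cos alpha * norm y) <= dot x u * dot y u)
    by (apply Rmult_le_compat; trivial; now apply Rmult_le_pos).
  rewrite cos_2a, E.
  assert (- (norm xo * norm yo) <= dot xo yo)
    by (unfold Rabs in Hd; destruct (Rcase_abs (dot xo yo)); lra).
  nra.
Qed.

(** * Transversality, points and chords of a cone *)

(** For unit vectors [e1], [e2] on the two lines, the larger eigenvalue of their Gram matrix is at
    most [1 + c], so the squared components of [D] along [e1] and [e2] add up to at most
    [(1 + c) |D|^2], and one of them is at most half of that. With [c = 1 - 2 sig^2] the angle
    between [D] and that line has sine at least [sig]. *)
Lemma transverse_camera (c : R) (D G1 G2 : pt) :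
  0 <= c -> Rabs (dot G1 G2) <= c * (norm G1 * norm G2) ->
  0 < norm G1 -> 0 < norm G2 ->
  2 * (dot D G1 * dot D G1) <= (1 + c) * (norm D * norm D * (norm G1 * norm G1)) \/
  2 * (dot D G2 * dot D G2) <= (1 + c) * (norm D * norm D * (norm G2 * norm G2)).
Proof.
  intros Hc Hg H1 H2.
  set (d1 := norm G1) in *; set (d2 := norm G2) in *.
  assert (E1 : d1 * d1 = dot G1 G1) by apply norm_sqr.
  assert (E2 : d2 * d2 = dot G2 G2) by apply norm_sqr.
  set (a1 := dot D G1 * d2); set (a2 := dot D G2 * d1).
  (* The components of [D] themselves serve as weights, which makes [dot D w] the sum of squares to
     be bounded; the lengths are multiplied through to avoid divisions. *)
  set (w := padd (pscale (a1 * d2) G1) (pscale (a2 * d1) G2)).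
  assert (Dw : dot D w = a1 * a1 + a2 * a2) by (unfold w, a1, a2; vring).
  assert (Ww : dot w w = d1 * d1 * (d2 * d2) * (a1 * a1 + a2 * a2)
                         + 2 * (a1 * a2) * (d1 * d2) * dot G1 G2).
  { replace (dot w w) with (a1 * a1 * (d2 * d2) * dot G1 G1 + a2 * a2 * (d1 * d1) * dot G2 G2
                            + 2 * (a1 * a2) * (d1 * d2) * dot G1 G2) by (unfold w; vring).
    rewrite <- E1, <- E2; ring. }
  pose proof (dot_sqr_le D w) as C; rewrite Dw, Ww, <- (norm_sqr D) in C.
  set (T := norm D) in *; set (A := a1 * a1 + a2 * a2) in *.
  assert (Hm : 2 * (a1 * a2) * (d1 * d2) * dot G1 G2 <= A * c * (d1 * d1 * (d2 * d2))).
  { assert (H0 : Rabs (2 * (a1 * a2)) <= A)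
      by (unfold A; apply Rabs_le; split;
          [pose proof (Rle_0_sqr (a1 + a2)) | pose proof (Rle_0_sqr (a1 - a2))];
          unfold Rsqr in *; lra).
    eapply Rle_trans; [apply Rle_abs|].
    rewrite !Rabs_mult, (Rabs_right d1), (Rabs_right d2) by lra.
    rewrite Rabs_mult in H0.
    replace (A * c * (d1 * d1 * (d2 * d2))) with (A * (d1 * d2) * (c * (d1 * d2))) by ring.
    apply Rmult_le_compat; trivial.
    - repeat apply Rmult_le_pos; try apply Rabs_pos; lra.
    - apply Rabs_pos.
    - apply Rmult_le_compat_r; [nra|]. rewrite Rabs_mult in H0; lra. }
  assert (HA : A <= (1 + c) * (T * T * (d1 * d1 * (d2 * d2)))).
  { assert (A0 : 0 <= A)
      by (unfold A; pose proof (Rle_0_sqr a1); pose proof (Rle_0_sqr a2); unfold Rsqr in *; lra).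
    assert (0 <= T * T) by apply Rle_0_sqr.
    assert (A * A <= (1 + c) * (T * T * (d1 * d1 * (d2 * d2))) * A).
    { eapply Rle_trans; [exact C|].
      replace ((1 + c) * (T * T * (d1 * d1 * (d2 * d2))) * A)
        with (T * T * (d1 * d1 * (d2 * d2) * A + A * c * (d1 * d1 * (d2 * d2)))) by ring.
      apply Rmult_le_compat_l; lra. }
    destruct (Rle_lt_or_eq_dec 0 A A0) as [Hp|He].
    - apply (Rmult_le_reg_r A); trivial.
    - rewrite <- He; pose proof (norm_nonneg D); repeat apply Rmult_le_pos; unfold T; lra. }
  assert (P1 : 0 < d1 * d1) by nra; assert (P2 : 0 < d2 * d2) by nra.
  destruct (Rle_dec (a1 * a1) (a2 * a2)); [left | right];
    [apply (Rmult_le_reg_r (d2 * d2)) | apply (Rmult_le_reg_r (d1 * d1))]; trivial;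
    unfold A, a1, a2 in *; nra.
Qed.

(* [G] points from the camera to the target and [P] from the target to another
   point of the cone; [P] makes an angle with cosine at most [gam] with the line of [G]. *)
Lemma point_dist_bound (s2 c2 sig gam : R) (G P : pt) :
  0 <= s2 -> 0 <= c2 -> s2 * s2 + c2 * c2 = 1 ->
  0 <= sig -> 0 <= gam -> sig * sig + gam * gam = 1 ->
  0 < norm G ->
  c2 * (norm G * norm (padd P G)) <= dot G (padd P G) ->
  dot P G * dot P G <= gam * gam * (norm P * norm P * (norm G * norm G)) ->
  norm P * (c2 * sig - s2 * gam) <= s2 * norm G.
Proof.
  intros Hs Hc Hsc Hsig Hgam Hsg Hd Hang Htr.
  set (d := norm G) in *; set (T := norm P) in *; set (N := norm (padd P G)) in *.
  assert (HT : 0 <= T) by apply norm_nonneg.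
  assert (HN : 0 <= N) by apply norm_nonneg.
  assert (EN : N * N = T * T + 2 * dot P G + d * d).
  { unfold N, T, d; rewrite !norm_sqr; vring. }
  replace (dot G (padd P G)) with (d * d + dot P G) in Hang
    by (unfold d; rewrite norm_sqr; vring).
  set (a := dot P G / d).
  assert (Ea : dot P G = a * d) by (unfold a; field; lra).
  rewrite Ea in *.
  assert (H1 : c2 * N <= d + a) by (apply (Rmult_le_reg_l d); trivial; lra).
  assert (Hga : Rabs a <= gam * T).
  { apply sqr_le_abs_le; [now apply Rmult_le_pos|].
    apply (Rmult_le_reg_r (d * d)); [nra|].
    replace (a * a * (d * d)) with (a * d * (a * d)) by ring.
    eapply Rle_trans; [exact Htr|]; right; ring. }
  assert (Ha2 : a * a <= gam * T * (gam * T)).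
  { pose proof (Rabs_pos a).
    replace (a * a) with (Rabs a * Rabs a) by (rewrite <- Rabs_mult; apply Rabs_right; nra).
    nra. }
  assert (H2 : c2 * N * (c2 * N) <= (d + a) * (d + a)).
  { assert (0 <= c2 * N) by now apply Rmult_le_pos. nra. }
  assert (H0 : 0 <= d + a) by (assert (0 <= c2 * N) by (now apply Rmult_le_pos); lra).
  (* The part of [P] orthogonal to [G] has length at least [sig * T] and, inside the cone of
     half-angle [2 * alpha], at most [s2 / c2] times the axial part [d + a]. Together with
     [a <= gam * T] this gives the sine-rule bound. *)
  assert (H3 : c2 * sig * T <= s2 * (d + a)).
  { apply sqr_le_le; [now apply Rmult_le_pos|].
    assert (E : c2 * c2 * (T * T - a * a) <= s2 * s2 * ((d + a) * (d + a))).
    { replace (s2 * s2) with (1 - c2 * c2) by lra.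
      replace (c2 * N * (c2 * N)) with (c2 * c2 * (N * N)) in H2 by ring.
      rewrite EN in H2; nra. }
    replace (s2 * (d + a) * (s2 * (d + a))) with (s2 * s2 * ((d + a) * (d + a))) by ring.
    eapply Rle_trans; [|exact E].
    replace (c2 * sig * T * (c2 * sig * T)) with (c2 * c2 * (sig * sig * (T * T))) by ring.
    apply Rmult_le_compat_l; [nra|].
    replace (sig * sig) with (1 - gam * gam) by lra; nra. }
  assert (a <= gam * T) by (eapply Rle_trans; [apply Rle_abs | exact Hga]).
  nra.
Qed.

Lemma cos_orth_le (alpha : R) (x u : pt) :
  norm u = 1 -> 0 <= sin alpha -> 0 <= cos alpha -> cos alpha * norm x <= dot x u ->
  cos alpha * norm (psub x (pscale (dot x u) u)) <= sin alpha * dot x u.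
Proof.
  intros Hu Hs Hc H; pose proof (norm_nonneg x).
  pose proof (orth_part_le alpha x u Hu Hs Hc H); nra.
Qed.

(** Let [beta] and [n] be the axial and orthogonal lengths of the chord and rotate this pair by
    [alpha]: [ca * beta - sa * n] and [ca * n + sa * beta] have squares adding up to [T * T].
    Transversality to [G], which lies within [alpha] of the axis, bounds the first by [gam * T]; the
    cone bounds the second by [2 * sin alpha * Rmax]. *)
Lemma cone_chord_bound (alpha sig gam Rmax : R) (G x y u : pt) :
  norm u = 1 -> 0 <= sin alpha -> 0 <= cos alpha ->
  0 <= sig -> 0 <= gam -> sig * sig + gam * gam = 1 ->
  sig <= cos alpha * cos alpha -> 0 < norm G ->
  cos alpha * norm G <= dot G u ->
  cos alpha * norm x <= dot x u ->
  cos alpha * norm y <= dot y u ->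
  norm x <= Rmax -> norm y <= Rmax ->
  dot (psub x y) G * dot (psub x y) G
    <= gam * gam * (norm (psub x y) * norm (psub x y) * (norm G * norm G)) ->
  sig * norm (psub x y) <= 2 * sin alpha * Rmax.
Proof.
  intros Hu Hs Hc Hsig Hgam Hsg Hsc Hd HG Hx Hy Rx Ry Htr.
  pose proof (cos_orth_le alpha x u Hu Hs Hc Hx) as Ox.
  pose proof (cos_orth_le alpha y u Hu Hs Hc Hy) as Oy.
  pose proof (orth_part_le alpha G u Hu Hs Hc HG) as OG.
  set (D := psub x y) in *; set (T := norm D) in *.
  set (b := dot D u).
  set (Do := psub D (pscale b u)).
  set (n := norm Do).
  assert (HT : 0 <= T) by apply norm_nonneg.
  assert (Hn : 0 <= n) by apply norm_nonneg.
  assert (En : n * n = T * T - b * b).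
  { unfold n, T, b, Do; rewrite !norm_sqr; now apply orth_part_sqr. }
  assert (Eb : b = dot x u - dot y u) by (unfold b, D; vring).
  assert (Hnxy : cos alpha * n <= sin alpha * (dot x u + dot y u)).
  { set (xo := psub x (pscale (dot x u) u)) in *.
    set (yo := psub y (pscale (dot y u) u)) in *.
    assert (Do = psub xo yo)
      by (unfold Do, xo, yo; rewrite Eb; unfold D, psub, pscale; simpl; f_equal; ring).
    unfold n; rewrite H; pose proof (norm_sub_le xo yo); nra. }
  assert (Ux : dot x u <= Rmax) by (pose proof (dot_le x u) as Q; rewrite Hu in Q; lra).
  assert (Uy : dot y u <= Rmax) by (pose proof (dot_le y u) as Q; rewrite Hu in Q; lra).
  (* The larger axial height is at most [Rmax] and the smaller one is less by [Rabs b]; this saving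
     supplies the term [sin alpha * Rabs b] of the rotated coordinate. *)
  assert (Hsum : dot x u + dot y u <= 2 * Rmax - Rabs b)
    by (unfold Rabs; destruct (Rcase_abs b); lra).
  assert (HB : cos alpha * n + sin alpha * Rabs b <= 2 * sin alpha * Rmax) by nra.
  assert (HDG : Rabs (dot D G) <= gam * T * norm G).
  { apply sqr_le_abs_le; [repeat apply Rmult_le_pos; trivial; lra|].
    eapply Rle_trans; [exact Htr|]; right; ring. }
  set (beta := Rabs b) in *.
  assert (Hbeta : 0 <= beta) by apply Rabs_pos.
  assert (Eb2 : beta * beta = b * b)
    by (unfold beta; rewrite <- Rabs_mult; apply Rabs_right; nra).
  assert (HA : cos alpha * beta - sin alpha * n <= gam * T).
  { set (Go := psub G (pscale (dot G u) u)) in *.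
    assert (E : dot D G = b * dot G u + dot Do Go).
    { assert (E : dot Do Go = dot D G - dot D u * dot G u * (2 - dot u u))
        by (unfold Do, Go, b; vring).
      rewrite <- (norm_sqr u), Hu in E; rewrite E; unfold b; ring. }
    assert (HDo : Rabs (dot Do Go) <= n * (sin alpha * norm G))
      by (eapply Rle_trans; [apply dot_abs_le|]; apply Rmult_le_compat_l; trivial).
    assert (Hb : beta * dot G u <= Rabs (dot D G) + Rabs (dot Do Go)).
    { replace (beta * dot G u) with (Rabs (dot D G - dot Do Go)).
      - unfold Rminus; rewrite <- (Rabs_Ropp (dot Do Go)); apply Rabs_triang.
      - replace (dot D G - dot Do Go) with (b * dot G u) by lra.
        unfold beta; rewrite Rabs_mult; f_equal; apply Rabs_right.
        assert (0 <= cos alpha * norm G) by (apply Rmult_le_pos; lra); lra. }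
    apply (Rmult_le_reg_r (norm G)); trivial.
    assert (beta * (cos alpha * norm G) <= beta * dot G u)
      by (apply Rmult_le_compat_l; trivial).
    lra. }
  pose proof (sin2_cos2 alpha) as E; unfold Rsqr in E.
  set (sa := sin alpha) in *; set (ca := cos alpha) in *.
  eapply Rle_trans; [|exact HB].
  (* If the first rotated coordinate is negative, an upper bound does not control its square. The
     chord is then within [alpha] of being orthogonal to the axis, so [n >= ca * T], and
     [sig <= ca * ca] suffices. *)
  destruct (Rle_dec 0 (ca * beta - sa * n)) as [A0|A0].
  - apply sqr_le_le; [nra|].
    assert (Eid : (ca * beta - sa * n) * (ca * beta - sa * n)
            + (ca * n + sa * beta) * (ca * n + sa * beta) = T * T).
    { replace ((ca * beta - sa * n) * (ca * beta - sa * n)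
            + (ca * n + sa * beta) * (ca * n + sa * beta))
        with ((sa * sa + ca * ca) * (n * n + beta * beta)) by ring.
      rewrite E, En, Eb2; ring. }
    assert ((ca * beta - sa * n) * (ca * beta - sa * n) <= gam * T * (gam * T)) by nra.
    replace (sig * T * (sig * T)) with ((1 - gam * gam) * (T * T))
      by (replace (1 - gam * gam) with (sig * sig) by lra; ring).
    lra.
  - assert (Hn2 : ca * T <= n).
    { apply sqr_le_le; trivial.
      assert (ca * beta * (ca * beta) <= sa * n * (sa * n)).
      { assert (0 <= ca * beta) by now apply Rmult_le_pos. nra. }
      replace (ca * T * (ca * T)) with (ca * ca * (T * T)) by ring.
      replace (T * T) with (n * n + beta * beta) by lra.
      nra. }
    assert (sig * T <= ca * ca * T) by (apply Rmult_le_compat_r; trivial).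
    assert (ca * (ca * T) <= ca * n) by (apply Rmult_le_compat_l; trivial).
    assert (0 <= sa * beta) by now apply Rmult_le_pos.
    lra.
Qed.

(** * Small angles and the lower bound from the viewing plane *)

(** The numerical consequences of [alpha <= 1/10]. The margin between 199/1000 and 1/5 is spent in
    [aperture_gap]. *)
Lemma small_angle_bounds (alpha : R) : 0 < alpha -> alpha <= 1/10 ->
  0 < sin alpha /\ 995/1000 <= cos alpha /\ 0 < sin (2 * alpha) <= 199/1000 /\
  0 < cos (2 * alpha).
Proof.
  intros H0 H1; pose proof PI2_3_2.
  assert (Hs : 0 < sin alpha) by (apply sin_gt_0; lra).
  assert (Hsa : sin alpha < alpha) by now apply sin_lt_x.
  pose proof (sin2_cos2 alpha) as E; unfold Rsqr in E.
  assert (Hc : 0 <= cos alpha) by (apply cos_ge_0; lra).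
  assert (Hc1 : 995/1000 <= cos alpha).
  { assert (E2 : cos alpha = 1 - 2 * sin (alpha / 2) * sin (alpha / 2))
      by (rewrite <- cos_2a_sin; f_equal; field).
    assert (0 < sin (alpha / 2)) by (apply sin_gt_0; lra).
    assert (sin (alpha / 2) < alpha / 2) by (apply sin_lt_x; lra).
    nra. }
  repeat split; trivial.
  - apply sin_gt_0; lra.
  - apply sqr_le_le; [lra|]; rewrite sin_2a.
    replace (2 * sin alpha * cos alpha * (2 * sin alpha * cos alpha))
      with (4 * (sin alpha * sin alpha) * (cos alpha * cos alpha)) by ring.
    replace (cos alpha * cos alpha) with (1 - sin alpha * sin alpha) by lra.
    assert (0 <= sin alpha * sin alpha <= 1/100) by nra.
    nra.
  - apply cos_gt_0; lra.
Qed.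

(* The vertical segment hanging down from the target is the longest one that starts at the
   target and is seen under an angle of at most [2 * alpha] from the whole plane. *)
Lemma plane_eps_lower (h alpha gx gy E : R) :
  0 < h -> 0 < alpha -> alpha <= 1/10 ->
  eps_le alpha (Pt gx gy 0) (plane h) E ->
  2 * h * sin (2 * alpha) <= E * (1 - sin (2 * alpha)).
Proof.
  intros Hh Ha0 Ha1 HE.
  destruct (small_angle_bounds alpha Ha0 Ha1) as (Hsa & Hca & [Hs0 Hs1] & Hc2).
  pose proof (sin2_cos2 (2 * alpha)) as Esc; unfold Rsqr in Esc.
  set (s2 := sin (2 * alpha)) in *; set (c2 := cos (2 * alpha)) in *.
  (* The circle through both ends of the segment that touches the viewing plane has radius
     [h + l / 2] and sees the segment under an angle of sine [l / (2 * h + l)]; this [l] makes that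
     sine equal to [s2]. *)
  set (l := 2 * h * s2 / (1 - s2)).
  assert (El : l * (1 - s2) = 2 * h * s2) by (unfold l; field; lra).
  assert (Hl : 0 < l) by (unfold l; apply Rdiv_lt_0_compat; nra).
  set (g := Pt gx gy 0) in *; set (q := Pt gx gy (- l)).
  (* Each direction is weighted by the length of the other, so both summands have the same length
     and the sum bisects the angle. *)
  set (bis := fun s => padd (pscale (norm (psub q s)) (psub g s))
                            (pscale (norm (psub g s)) (psub q s))).
  set (U := fun s => pscale (/ norm (bis s)) (bis s)).
  assert (Key : forall s, plane h s ->
    norm (U s) = 1 /\ in_cone alpha s (U s) g /\ in_cone alpha s (U s) q).
  { intros [sx sy sz] Hp; unfold plane in Hp; simpl in Hp; subst sz.
    set (s := Pt sx sy h).
    set (x := psub g s) in *; set (y := psub q s) in *.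
    set (m := norm x); set (n := norm y).
    set (r := (gx - sx) * (gx - sx) + (gy - sy) * (gy - sy)).
    assert (Hr : 0 <= r)
      by (pose proof (Rle_0_sqr (gx - sx)); pose proof (Rle_0_sqr (gy - sy));
          unfold r, Rsqr in *; lra).
    assert (Ex : m * m = r + h * h)
      by (unfold m; rewrite norm_sqr; unfold x, g, s, r; vring).
    assert (Ey : n * n = r + (h + l) * (h + l))
      by (unfold n; rewrite norm_sqr; unfold y, q, s, r; vring).
    assert (Exy : dot x y = r + h * (h + l))
      by (unfold x, y, g, q, s, r; vring).
    assert (Hm : 0 < m).
    { destruct (Rle_lt_or_eq_dec 0 m (norm_nonneg _)) as [|Z]; trivial.
      exfalso; rewrite <- Z in Ex; nra. }
    assert (Hn : 0 < n).
    { destruct (Rle_lt_or_eq_dec 0 n (norm_nonneg _)) as [|Z]; trivial.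
      exfalso; rewrite <- Z in Ey; nra. }
    assert (Hmn : 0 < m * n) by now apply Rmult_lt_0_compat.
    assert (Hxy : c2 * (m * n) <= dot x y).
    { apply sqr_le_le; [rewrite Exy; nra|].
      replace (c2 * (m * n) * (c2 * (m * n))) with (c2 * c2 * ((m * m) * (n * n))) by ring.
      rewrite Ex, Ey, Exy.
      (* The squared form of [l = (2 * h + l) * s2]. The rest is the arithmetic-geometric mean
         inequality for [r] and [h * (h + l)], sharp at the point of tangency, where
         [r = h * (h + l)]. *)
      assert (E4 : l * l * (c2 * c2) = 4 * (h * (h + l)) * (s2 * s2)).
      { replace (c2 * c2) with (1 - s2 * s2) by lra.
        assert (El2 : l = (2 * h + l) * s2) by lra.
        replace (4 * (h * (h + l)) * (s2 * s2))
          with (((2 * h + l) * s2) * ((2 * h + l) * s2) - l * l * (s2 * s2)) by ring.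
        rewrite <- El2; ring. }
      set (N := r + h * (h + l)).
      replace ((r + h * h) * (r + (h + l) * (h + l))) with (N * N + r * (l * l))
        by (unfold N; ring).
      assert (4 * (h * (h + l)) * r <= N * N)
        by (unfold N; pose proof (Rle_0_sqr (r - h * (h + l))) as Q; unfold Rsqr in Q; lra).
      replace (c2 * c2 * (N * N + r * (l * l)))
        with (c2 * c2 * (N * N) + r * (l * l * (c2 * c2))) by ring.
      rewrite E4.
      replace (N * N) with ((s2 * s2 + c2 * c2) * (N * N)) at 2 by (rewrite Esc; ring).
      assert (0 <= s2 * s2) by nra.
      nra. }
    set (w := bis s).
    assert (Ew : w = padd (pscale n x) (pscale m y)) by reflexivity.
    assert (Eww : dot w w = 2 * (m * n) * (m * n + dot x y)).
    { rewrite Ew.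
      replace (dot (padd (pscale n x) (pscale m y)) (padd (pscale n x) (pscale m y)))
        with (n * n * dot x x + 2 * (m * n) * dot x y + m * m * dot y y) by vring.
      rewrite <- (norm_sqr x), <- (norm_sqr y); fold m n; ring. }
    assert (Hxy0 : 0 < dot x y) by (rewrite Exy; nra).
    assert (Hw : 0 < norm w).
    { destruct (Rle_lt_or_eq_dec 0 (norm w) (norm_nonneg _)) as [|Z]; trivial.
      exfalso; pose proof (norm_sqr w) as Q; rewrite <- Z, Eww in Q; nra. }
    assert (Hiw : 0 < / norm w) by now apply Rinv_0_lt_compat.
    assert (HU : norm (U s) = 1)
      by (unfold U; fold w; rewrite norm_scale by lra; apply Rinv_l; lra).
    assert (Ecc : c2 = 2 * cos alpha * cos alpha - 1) by apply cos_2a_cos.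
    assert (Hcw : cos alpha * norm w <= m * n + dot x y).
    { apply sqr_le_le; [lra|].
      replace (cos alpha * norm w * (cos alpha * norm w))
        with (cos alpha * cos alpha * (norm w * norm w)) by ring.
      rewrite norm_sqr, Eww.
      replace (cos alpha * cos alpha * (2 * (m * n) * (m * n + dot x y)))
        with ((1 + c2) * (m * n) * (m * n + dot x y)) by (rewrite Ecc; ring).
      apply Rmult_le_compat_r; lra. }
    assert (Edx : dot x (U s) = m * (/ norm w * (m * n + dot x y))).
    { unfold U; fold w.
      replace (dot x (pscale (/ norm w) w)) with (/ norm w * dot x w) by vring.
      replace (dot x w) with (n * dot x x + m * dot x y) by (rewrite Ew; vring).
      rewrite <- (norm_sqr x); fold m; ring. }
    assert (Edy : dot y (U s) = n * (/ norm w * (m * n + dot x y))).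
    { unfold U; fold w.
      replace (dot y (pscale (/ norm w) w)) with (/ norm w * dot y w) by vring.
      replace (dot y w) with (n * dot x y + m * dot y y) by (rewrite Ew; vring).
      rewrite <- (norm_sqr y); fold n; ring. }
    assert (Hcc : cos alpha <= / norm w * (m * n + dot x y)).
    { replace (cos alpha) with (/ norm w * (cos alpha * norm w)) by (field; lra).
      apply Rmult_le_compat_l; lra. }
    pose proof PI2_3_2.
    split; [exact HU|]; split; apply in_cone_intro; try (fold x); try (fold y);
      try (fold m); try (fold n); trivial; try lra.
    - rewrite Edx, Rmult_comm; apply Rmult_le_compat_l; lra.
    - rewrite Edy, Rmult_comm; apply Rmult_le_compat_l; lra. }
  assert (HlE : Defs.dist g q <= E).
  { apply (HE U); intros s Hs; destruct (Key s Hs) as (A & B & C); auto. }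
  replace (Defs.dist g q) with l in HlE.
  - rewrite <- El; apply Rmult_le_compat_r; lra.
  - unfold Defs.dist, norm.
    replace (dot (psub g q) (psub g q)) with (l * l) by (unfold g, q; vring).
    symmetry; apply sqrt_square; lra.
Qed.

(** * The upper bound for two cameras *)

(* This is where the constant [1/5], a bound for [2 * alpha], enters. *)
Lemma aperture_gap (s2 c2 sig gam : R) :
  0 <= s2 <= 199/1000 -> 0 <= c2 -> s2 * s2 + c2 * c2 = 1 ->
  1/5 <= sig -> 2 * (sig * sig) <= 1 -> 0 <= gam -> sig * sig + gam * gam = 1 ->
  sig - 1/5 <= c2 * sig - s2 * gam.
Proof.
  intros [Hs0 Hs1] Hc Hsc Hsig Hsig1 Hgam Hsg.
  assert (Hs2 : 0 <= s2 * s2 <= 199/1000 * (199/1000)) by nra.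
  (* Quadratic bounds replace the square roots. A lower bound needs a coefficient above 1/2, and
     51/100 is valid in the range of [s2]. *)
  assert (Hc1 : 1 - 51/100 * (s2 * s2) <= c2) by (apply sqr_le_le; nra).
  assert (Hg1 : gam <= 1 - sig * sig / 2) by (apply sqr_le_le; nra).
  assert (H1 : (1 - 51/100 * (s2 * s2)) * sig <= c2 * sig) by nra.
  assert (H2 : s2 * gam <= s2 * (1 - sig * sig / 2)) by nra.
  assert (Hsig2 : sig <= 1) by nra.
  assert (Hsx : 0 <= s2 * sig) by nra.
  assert (s2 * sig <= 199/1000) by nra.
  (* At the extreme values [sig = 1/5] and [s2 = 199/1000] the bracket is about -0.0015. The total
     loss is therefore at most [s2 + 2/1000 * (199/1000)], still below 1/5. *)
  assert (- (2/1000) * (s2 * sig) <= (sig / 2 - 51/100 * s2) * (s2 * sig)) by nra.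
  lra.
Qed.

(** The target-to-point vectors and the chord are each charged to whichever camera is transverse to
    them, possibly different cameras. The conclusion is multiplied by [sig - 1/5] to clear the
    denominator of the ball radius [M]. *)
Lemma pair_eps_bound (alpha sig d : R) (g s1 s2 p q u1 u2 : pt) :
  0 < alpha -> alpha <= 1/10 -> 1/5 < sig -> 2 * (sig * sig) <= 1 ->
  0 < norm (psub g s1) <= d -> 0 < norm (psub g s2) <= d ->
  Rabs (dot (psub g s1) (psub g s2))
    <= (1 - 2 * (sig * sig)) * (norm (psub g s1) * norm (psub g s2)) ->
  norm u1 = 1 -> norm u2 = 1 ->
  in_cone alpha s1 u1 g -> in_cone alpha s1 u1 p -> in_cone alpha s1 u1 q ->
  in_cone alpha s2 u2 g -> in_cone alpha s2 u2 p -> in_cone alpha s2 u2 q ->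
  sig * Defs.dist p q * (sig - 1/5)
    <= 2 * sin alpha * (d * (sig - 1/5 + sin (2 * alpha))).
Proof.
  intros Ha0 Ha1 Hsig Hsig1 [G1 D1] [G2 D2] Hdot U1 U2 C1g C1p C1q C2g C2p C2q.
  destruct (small_angle_bounds alpha Ha0 Ha1) as (Hsa & Hca & [Hs0 Hs1] & Hc2).
  pose proof (sin2_cos2 (2 * alpha)) as Esc; unfold Rsqr in Esc.
  pose proof PI2_3_2 as HPI.
  assert (HaPI : alpha <= PI) by lra.
  apply in_cone_cos in C1g, C1p, C1q, C2g, C2p, C2q; trivial.
  set (gam := sqrt (1 - sig * sig)).
  assert (Hgam : 0 <= gam) by apply sqrt_pos.
  assert (Egam : gam * gam = 1 - sig * sig) by (apply sqrt_sqrt; lra).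
  assert (Hgap : sig - 1/5 <= cos (2 * alpha) * sig - sin (2 * alpha) * gam)
    by (apply aperture_gap; lra).
  assert (Tr : forall D,
    dot D (psub g s1) * dot D (psub g s1)
      <= gam * gam * (norm D * norm D * (norm (psub g s1) * norm (psub g s1))) \/
    dot D (psub g s2) * dot D (psub g s2)
      <= gam * gam * (norm D * norm D * (norm (psub g s2) * norm (psub g s2)))).
  { intros D.
    destruct (transverse_camera (1 - 2 * (sig * sig)) D (psub g s1) (psub g s2))
      as [T|T]; trivial; try lra; rewrite Egam; [left | right]; lra. }
  set (M := sin (2 * alpha) * d / (sig - 1/5)).
  assert (EM : M * (sig - 1/5) = sin (2 * alpha) * d) by (unfold M; field; lra).
  assert (HM : forall x,
    cos alpha * norm (psub x s1) <= dot (psub x s1) u1 ->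
    cos alpha * norm (psub x s2) <= dot (psub x s2) u2 -> norm (psub x g) <= M).
  { intros x X1 X2; pose proof (norm_nonneg (psub x g)).
    apply (Rmult_le_reg_r (sig - 1/5)); [lra|]; rewrite EM.
    apply Rle_trans with
      (norm (psub x g) * (cos (2 * alpha) * sig - sin (2 * alpha) * gam)).
    { now apply Rmult_le_compat_l. }
    assert (Edec : forall s, padd (psub x g) (psub g s) = psub x s)
      by (intros s; unfold padd, psub; simpl; f_equal; ring).
    destruct (Tr (psub x g)) as [T|T].
    - apply Rle_trans with (sin (2 * alpha) * norm (psub g s1)); [|apply Rmult_le_compat_l; lra].
      apply point_dist_bound; try lra; rewrite Edec.
      apply cone_pair_angle with u1; trivial; lra.
    - apply Rle_trans with (sin (2 * alpha) * norm (psub g s2)); [|apply Rmult_le_compat_l; lra].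
      apply point_dist_bound; try lra; rewrite Edec.
      apply cone_pair_angle with u2; trivial; lra. }
  (* The ball around the target turns into a distance bound from either camera, the [Rmax] of the
     chord estimate. *)
  assert (HR : forall x s, norm (psub g s) <= d -> norm (psub x g) <= M ->
                           norm (psub x s) <= d + M).
  { intros x s A B.
    replace (psub x s) with (psub (psub x g) (psub s g))
      by (unfold psub; simpl; f_equal; ring).
    replace (norm (psub g s)) with (norm (psub s g)) in A
      by (unfold norm; f_equal; vring).
    pose proof (norm_sub_le (psub x g) (psub s g)); lra. }
  assert (sig <= 9/10) by nra.
  assert (Hcc : sig <= cos alpha * cos alpha) by nra.
  assert (Hchord : sig * Defs.dist p q <= 2 * sin alpha * (d + M)).
  { unfold Defs.dist.
    assert (Edif : forall s, psub p q = psub (psub p s) (psub q s))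
      by (intros s; unfold psub; simpl; f_equal; ring).
    destruct (Tr (psub p q)) as [T|T]; [rewrite (Edif s1) in * | rewrite (Edif s2) in *].
    - apply (cone_chord_bound alpha sig gam (d + M) (psub g s1) _ _ u1); auto; lra.
    - apply (cone_chord_bound alpha sig gam (d + M) (psub g s2) _ _ u2); auto; lra. }
  replace (2 * sin alpha * (d * (sig - 1/5 + sin (2 * alpha))))
    with (2 * sin alpha * (d + M) * (sig - 1/5)) by (replace (2 * sin alpha * (d + M) * (sig - 1/5))
        with (2 * sin alpha * (d * (sig - 1/5) + M * (sig - 1/5))) by ring; rewrite EM; ring).
  apply Rmult_le_compat_r; lra.
Qed.

(** * Choosing two cameras of the grid *)

(* [vL], [vH] stand for [lh], [1 + lv]; [(vFx, vFy)] is the position of the target in its grid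
   cell, and [vPos k i j] a coordinate of camera [(i, j)] relative to the target, all for
   [h = 1]. Integers bounding a variable are scaled by 20. *)
Inductive coord := cX | cY | cZ.
Inductive var := vL | vH | vFx | vFy | vPos (k : coord) (i j : Z).

(* [Split x v lo hi] continues in [lo] if [20 x <= v] and in [hi] otherwise. A leaf selects the
   cameras [(i, j)] and [(i', j')] with [sig = w / 1000]; [(pu, qu) / 65] and [(pl, ql) / 65]
   are the rotations used in [rotated_dot_le] to bound their dot product from above and from
   below. *)
Inductive tree :=
| Split (x : var) (v : Z) (lo hi : tree)
| Leaf (i j i' j' w pu qu pl ql : Z).

(* [p] and [q] are the vectors from the target to two cameras for [h = 1]; the angle of their
   lines has a half with sine at least [sig]. *)
Definition good_pair (lam H : R) (p q : pt) : Prop :=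
  exists sig, 1/5 < sig /\ 2 * (sig * sig) <= 1 /\
    (1 - lam) * norm p <= 6 * (sig - 1/5) * H /\
    (1 - lam) * norm q <= 6 * (sig - 1/5) * H /\
    Rabs (dot p q) <= (1 - 2 * (sig * sig)) * (norm p * norm q).

Definition near_grid (lam H fx fy : R) (P : Z -> Z -> pt) : Prop :=
  forall i j, Rabs (px (P i j) - (IZR i - fx)) <= lam /\
              Rabs (py (P i j) - (IZR j - fy)) <= lam /\
              Rabs (pz (P i j) - 1) <= H - 1.

(** * An integer checker for decision trees *)

Definition coord_eqb (k l : coord) : bool :=
  match k, l with cX, cX | cY, cY | cZ, cZ => true | _, _ => false end.

Definition var_eqb (x y : var) : bool :=
  match x, y with
  | vL, vL | vH, vH | vFx, vFx | vFy, vFy => true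
  | vPos k i j, vPos k' i' j' => coord_eqb k k' && (Z.eqb i i' && Z.eqb j j')
  | _, _ => false
  end.

Lemma var_eqb_eq (x y : var) : var_eqb x y = true -> x = y.
Proof.
  destruct x as [| | | |k i j], y as [| | | |k' i' j']; simpl; try easy.
  rewrite !andb_true_iff, !Z.eqb_eq; intros (E & -> & ->).
  destruct k, k'; easy.
Qed.

(** [us] and [ls] collect the cuts met on the way from the root; [d] is a bound that is valid
    without any cut on [x] itself. *)
Definition cut_above (us : list (var * Z)) (x : var) (d : Z) : Z :=
  fold_right (fun c m => if var_eqb x (fst c) then Z.min (snd c) m else m) d us.

Definition cut_below (ls : list (var * Z)) (x : var) (d : Z) : Z :=
  fold_right (fun c m => if var_eqb x (fst c) then Z.max (snd c) m else m) d ls.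

(** A camera coordinate takes its default from the current cuts on [vL], [vH], [vFx] and [vFy], so
    that splitting those also shrinks the boxes of the cameras. [vFx] and [vFy] stop at 10, half a
    cell, because reflections supply the rest. *)
Definition upper (us ls : list (var * Z)) (x : var) : Z :=
  cut_above us x
    match x with
    | vL => 20
    | vH => 40
    | vFx | vFy => 10
    | vPos cX i _ => 20 * i - cut_below ls vFx 0 + cut_above us vL 20
    | vPos cY _ j => 20 * j - cut_below ls vFy 0 + cut_above us vL 20
    | vPos cZ _ _ => cut_above us vH 40
    end.

Definition lower (us ls : list (var * Z)) (x : var) : Z :=
  cut_below ls x
    match x with
    | vL => 0
    | vH => 20
    | vFx | vFy => 0
    | vPos cX i _ => 20 * i - cut_above us vFx 10 - cut_above us vL 20
    | vPos cY _ j => 20 * j - cut_above us vFy 10 - cut_above us vL 20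
    | vPos cZ _ _ => 40 - cut_above us vH 40
    end.

Definition corners_nonneg (A B K x0 x1 y0 y1 x0' x1' y0' y1' : Z) : bool :=
  forallb (fun x => forallb (fun y => forallb (fun x' => forallb (fun y' =>
    Z.leb 0 (A * (x * x' + y * y') + B * (x * y' - y * x') + K))
    (y0' :: y1' :: nil)) (x0' :: x1' :: nil)) (y0 :: y1 :: nil)) (x0 :: x1 :: nil).

(** The squared distance of the farthest corner of a box. Only [z1] enters for the height, as a leaf
    also requires the lower end of the height to be nonnegative. *)
Definition far_corner (x0 x1 y0 y1 z1 : Z) : Z :=
  Z.max (x0 * x0) (x1 * x1) + Z.max (y0 * y0) (y1 * y1) + z1 * z1.

(** Here [c / 500000] is [1 - 2 sig^2]. The distance tests are the squares of
    [(1 - lam) |p| <= 6 (sig - 1/5) H] at the worst ends [l0] and [h0]. The corner tests put the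
    bilinear lower bounds in place of the product of norms; [z z'] is then left with coefficient
    [-65 w^2] in one test and [65 (500000 + c)] in the other, hence the products [z1 * z1'] and
    [z0 * z0']. The denominator 65 is the hypotenuse of the triples with legs 16, 63; 25, 60; 33,
    56; 39, 52, which offers many exact rotations. *)
Definition leaf_ok (us ls : list (var * Z)) (i j i' j' w pu qu pl ql : Z) : bool :=
  let x0 := lower us ls (vPos cX i j) in let x1 := upper us ls (vPos cX i j) in
  let y0 := lower us ls (vPos cY i j) in let y1 := upper us ls (vPos cY i j) in
  let z0 := lower us ls (vPos cZ i j) in let z1 := upper us ls (vPos cZ i j) in
  let x0' := lower us ls (vPos cX i' j') in let x1' := upper us ls (vPos cX i' j') in
  let y0' := lower us ls (vPos cY i' j') in let y1' := upper us ls (vPos cY i' j') in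
  let z0' := lower us ls (vPos cZ i' j') in let z1' := upper us ls (vPos cZ i' j') in
  let l0 := lower us ls vL in let h0 := lower us ls vH in
  let r := (36 * 400 * ((w - 200) * (w - 200)) * (h0 * h0))%Z in
  let c := (500000 - w * w)%Z in
  (Z.leb 0 z0 && Z.leb 0 z0' && Z.leb l0 20 && Z.ltb 200 w && Z.leb 0 c && Z.leb 0 h0
   && Z.leb (pu * pu + qu * qu) (65 * 65) && Z.leb (pl * pl + ql * ql) (65 * 65)
   && Z.leb (1000000 * ((20 - l0) * (20 - l0)) * far_corner x0 x1 y0 y1 z1) r
   && Z.leb (1000000 * ((20 - l0) * (20 - l0)) * far_corner x0' x1' y0' y1' z1') r
   && corners_nonneg (c * pu - 65 * 500000) (c * qu) (- (65 * (w * w) * (z1 * z1')))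
        x0 x1 y0 y1 x0' x1' y0' y1'
   && corners_nonneg (c * pl + 65 * 500000) (c * ql) (65 * (500000 + c) * (z0 * z0'))
        x0 x1 y0 y1 x0' x1' y0' y1')%bool.

Fixpoint tree_ok (us ls : list (var * Z)) (t : tree) : bool :=
  match t with
  | Split x v lo hi => tree_ok ((x, v) :: us) ls lo && tree_ok us ((x, v) :: ls) hi
  | Leaf i j i' j' w pu qu pl ql => leaf_ok us ls i j i' j' w pu qu pl ql
  end.

(** * Soundness of the checker *)

Lemma Rabs_le_bounds (x a : R) : Rabs x <= a -> - a <= x <= a.
Proof. unfold Rabs; destruct (Rcase_abs x); lra. Qed.

Definition value (lam H fx fy : R) (P : Z -> Z -> pt) (x : var) : R :=
  match x with
  | vL => lam | vH => H | vFx => fx | vFy => fy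
  | vPos cX i j => px (P i j) | vPos cY i j => py (P i j) | vPos cZ i j => pz (P i j)
  end.

Lemma cut_above_sound (val : var -> R) us x d :
  Forall (fun c => 20 * val (fst c) <= IZR (snd c)) us -> 20 * val x <= IZR d ->
  20 * val x <= IZR (cut_above us x d).
Proof.
  induction 1 as [|[y v] us Hc _ IH]; intros Hd; simpl; auto.
  destruct (var_eqb x y) eqn:E; auto.
  apply var_eqb_eq in E; subst y; simpl in Hc.
  destruct (Z.min_spec v (cut_above us x d)) as [[_ ->]|[_ ->]]; auto.
Qed.

Lemma cut_below_sound (val : var -> R) ls x d :
  Forall (fun c => IZR (snd c) <= 20 * val (fst c)) ls -> IZR d <= 20 * val x ->
  IZR (cut_below ls x d) <= 20 * val x.
Proof.
  induction 1 as [|[y v] ls Hc _ IH]; intros Hd; simpl; auto.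
  destruct (var_eqb x y) eqn:E; auto.
  apply var_eqb_eq in E; subst y; simpl in Hc.
  destruct (Z.max_spec v (cut_below ls x d)) as [[_ ->]|[_ ->]]; auto.
Qed.

Lemma bounds_sound lam H fx fy P us ls x :
  0 <= lam <= 1 -> 1 <= H <= 2 -> 0 <= fx <= 1/2 -> 0 <= fy <= 1/2 ->
  near_grid lam H fx fy P ->
  Forall (fun c => 20 * value lam H fx fy P (fst c) <= IZR (snd c)) us ->
  Forall (fun c => IZR (snd c) <= 20 * value lam H fx fy P (fst c)) ls ->
  IZR (lower us ls x) <= 20 * value lam H fx fy P x <= IZR (upper us ls x).
Proof.
  intros HL HH HX HY HP Hus Hls.
  assert (ub : forall y d, 20 * value lam H fx fy P y <= IZR d ->
     20 * value lam H fx fy P y <= IZR (cut_above us y d))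
    by (intros; now apply cut_above_sound).
  assert (lb : forall y d, IZR d <= 20 * value lam H fx fy P y ->
     IZR (cut_below ls y d) <= 20 * value lam H fx fy P y)
    by (intros; now apply cut_below_sound).
  assert (uL : 20 * lam <= IZR (cut_above us vL 20)) by (apply (ub vL); simpl; lra).
  assert (uH : 20 * H <= IZR (cut_above us vH 40)) by (apply (ub vH); simpl; lra).
  assert (uX : 20 * fx <= IZR (cut_above us vFx 10)) by (apply (ub vFx); simpl; lra).
  assert (uY : 20 * fy <= IZR (cut_above us vFy 10)) by (apply (ub vFy); simpl; lra).
  assert (lX : IZR (cut_below ls vFx 0) <= 20 * fx) by (apply (lb vFx); simpl; lra).
  assert (lY : IZR (cut_below ls vFy 0) <= 20 * fy) by (apply (lb vFy); simpl; lra).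
  unfold lower, upper; split; [apply lb | apply ub];
    destruct x as [| | | |[| |] i j]; cbn [value]; try lra;
    destruct (HP i j) as (PX & PY & PZ);
    apply Rabs_le_bounds in PX, PY, PZ;
    rewrite ?plus_IZR, ?minus_IZR, ?mult_IZR; lra.
Qed.

Lemma affine_nonneg (k m a b x : R) :
  a <= x <= b -> 0 <= k * a + m -> 0 <= k * b + m -> 0 <= k * x + m.
Proof. intros [? ?] ? ?; destruct (Rle_dec 0 k); nra. Qed.

(** The function is affine in each of the four variables separately, so it is nonnegative on the box
    once it is at the corners. [V1], [V2], [V3] release the corner values one variable at a time,
    from the last to the second. *)
Lemma corners_nonneg_sound (A B K x0 x1 y0 y1 x0' x1' y0' y1' : Z) (x y x' y' : R) :
  corners_nonneg A B K x0 x1 y0 y1 x0' x1' y0' y1' = true ->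
  IZR x0 <= x <= IZR x1 -> IZR y0 <= y <= IZR y1 ->
  IZR x0' <= x' <= IZR x1' -> IZR y0' <= y' <= IZR y1' ->
  0 <= IZR A * (x * x' + y * y') + IZR B * (x * y' - y * x') + IZR K.
Proof.
  intros Hc Hx Hy Hx' Hy'.
  set (f := fun x y x' y' => IZR A * (x * x' + y * y') + IZR B * (x * y' - y * x') + IZR K).
  assert (V : forall u v u' v', In u (x0 :: x1 :: nil) -> In v (y0 :: y1 :: nil) ->
    In u' (x0' :: x1' :: nil) -> In v' (y0' :: y1' :: nil) ->
    0 <= f (IZR u) (IZR v) (IZR u') (IZR v')).
  { intros u v u' v' Hu Hv Hu' Hv'; unfold corners_nonneg in Hc.
    apply (proj1 (forallb_forall _ _)) with (x := u) in Hc; trivial.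
    apply (proj1 (forallb_forall _ _)) with (x := v) in Hc; trivial.
    apply (proj1 (forallb_forall _ _)) with (x := u') in Hc; trivial.
    apply (proj1 (forallb_forall _ _)) with (x := v') in Hc; trivial.
    apply Z.leb_le, IZR_le in Hc; unfold f.
    now rewrite !plus_IZR, !mult_IZR, minus_IZR, plus_IZR, !mult_IZR in Hc. }
  assert (V1 : forall u v u', In u (x0 :: x1 :: nil) -> In v (y0 :: y1 :: nil) ->
    In u' (x0' :: x1' :: nil) -> 0 <= f (IZR u) (IZR v) (IZR u') y').
  { intros u v u' Hu Hv Hu'.
    replace (f (IZR u) (IZR v) (IZR u') y')
      with ((IZR A * IZR v + IZR B * IZR u) * y' + f (IZR u) (IZR v) (IZR u') 0)
      by (unfold f; ring).
    apply affine_nonneg with (1 := Hy').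
    - eapply Rle_trans; [apply (V u v u' y0'); simpl; auto|]; unfold f; right; ring.
    - eapply Rle_trans; [apply (V u v u' y1'); simpl; auto|]; unfold f; right; ring. }
  assert (V2 : forall u v, In u (x0 :: x1 :: nil) -> In v (y0 :: y1 :: nil) ->
    0 <= f (IZR u) (IZR v) x' y').
  { intros u v Hu Hv.
    replace (f (IZR u) (IZR v) x' y')
      with ((IZR A * IZR u - IZR B * IZR v) * x' + f (IZR u) (IZR v) 0 y')
      by (unfold f; ring).
    apply affine_nonneg with (1 := Hx').
    - eapply Rle_trans; [apply (V1 u v x0'); simpl; auto|]; unfold f; right; ring.
    - eapply Rle_trans; [apply (V1 u v x1'); simpl; auto|]; unfold f; right; ring. }
  assert (V3 : forall u, In u (x0 :: x1 :: nil) -> 0 <= f (IZR u) y x' y').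
  { intros u Hu.
    replace (f (IZR u) y x' y')
      with ((IZR A * y' - IZR B * x') * y + f (IZR u) 0 x' y') by (unfold f; ring).
    apply affine_nonneg with (1 := Hy).
    - eapply Rle_trans; [apply (V2 u y0); simpl; auto|]; unfold f; right; ring.
    - eapply Rle_trans; [apply (V2 u y1); simpl; auto|]; unfold f; right; ring. }
  change (0 <= f x y x' y').
  replace (f x y x' y')
    with ((IZR A * x' + IZR B * y') * x + f 0 y x' y') by (unfold f; ring).
  apply affine_nonneg with (1 := Hx).
  - eapply Rle_trans; [apply (V3 x0); simpl; auto|]; unfold f; right; ring.
  - eapply Rle_trans; [apply (V3 x1); simpl; auto|]; unfold f; right; ring.
Qed.

Lemma far_corner_sound (x0 x1 y0 y1 z0 z1 : Z) (x y z : R) :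
  IZR x0 <= x <= IZR x1 -> IZR y0 <= y <= IZR y1 -> 0 <= IZR z0 ->
  IZR z0 <= z <= IZR z1 ->
  x * x + y * y + z * z <= IZR (far_corner x0 x1 y0 y1 z1).
Proof.
  intros Hx Hy Hz0 Hz; unfold far_corner; rewrite !plus_IZR.
  assert (M : forall a b t, IZR a <= t <= IZR b -> t * t <= IZR (Z.max (a * a) (b * b))).
  { intros a b t Ht.
    destruct (Rle_dec 0 t).
    - apply Rle_trans with (IZR (b * b)); [rewrite mult_IZR; nra | apply IZR_le; lia].
    - apply Rle_trans with (IZR (a * a)); [rewrite mult_IZR; nra | apply IZR_le; lia]. }
  pose proof (M _ _ _ Hx); pose proof (M _ _ _ Hy).
  assert (z * z <= IZR (z1 * z1)) by (rewrite mult_IZR; nra).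
  lra.
Qed.

(* Rotating [q] about the vertical axis and applying Cauchy-Schwarz. *)
Lemma rotated_dot_le (c s r x y z x' y' z' : R) :
  0 <= r -> c * c + s * s <= r * r ->
  c * (x * x' + y * y') + s * (x * y' - y * x') + r * (z * z')
    <= r * (norm (Pt x y z) * norm (Pt x' y' z')).
Proof.
  intros Hr Hcs.
  set (p := Pt x y z); set (q := Pt x' y' z').
  set (q' := Pt (c * x' + s * y') (c * y' - s * x') (r * z')).
  replace (c * (x * x' + y * y') + s * (x * y' - y * x') + r * (z * z')) with (dot p q')
    by (unfold p, q'; vring).
  eapply Rle_trans; [apply dot_le|].
  replace (r * (norm p * norm q)) with (norm p * (r * norm q)) by ring.
  apply Rmult_le_compat_l; [apply norm_nonneg|].
  apply sqr_le_le; [apply Rmult_le_pos; trivial; apply norm_nonneg|].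
  replace (r * norm q * (r * norm q)) with (r * r * (norm q * norm q)) by ring.
  rewrite !norm_sqr.
  replace (dot q' q') with ((c * c + s * s) * (x' * x' + y' * y') + r * r * (z' * z'))
    by (unfold q'; vring).
  replace (dot q q) with (x' * x' + y' * y' + z' * z') by (unfold q; vring).
  assert (0 <= x' * x' + y' * y') by nra.
  nra.
Qed.

Lemma leaf_ok_sound lam H fx fy P us ls i j i' j' w pu qu pl ql :
  0 <= lam <= 1 -> 1 <= H <= 2 -> 0 <= fx <= 1/2 -> 0 <= fy <= 1/2 ->
  near_grid lam H fx fy P ->
  Forall (fun c => 20 * value lam H fx fy P (fst c) <= IZR (snd c)) us ->
  Forall (fun c => IZR (snd c) <= 20 * value lam H fx fy P (fst c)) ls ->
  leaf_ok us ls i j i' j' w pu qu pl ql = true ->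
  good_pair lam H (P i j) (P i' j').
Proof.
  intros HL HH HX HY HP Hus Hls Hok.
  assert (Bd : forall x, IZR (lower us ls x) <= 20 * value lam H fx fy P x
                         <= IZR (upper us ls x))
    by (intros; now apply bounds_sound).
  unfold leaf_ok in Hok; cbv zeta in Hok.
  pose proof (Bd (vPos cX i j)) as Bx; pose proof (Bd (vPos cY i j)) as By.
  pose proof (Bd (vPos cZ i j)) as Bz; pose proof (Bd (vPos cX i' j')) as Bx'.
  pose proof (Bd (vPos cY i' j')) as By'; pose proof (Bd (vPos cZ i' j')) as Bz'.
  pose proof (Bd vL) as BL; pose proof (Bd vH) as BH; cbn [value] in *.
  revert Bx By Bz Bx' By' Bz' BL BH Hok.
  generalize (lower us ls (vPos cX i j)) (upper us ls (vPos cX i j))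
    (lower us ls (vPos cY i j)) (upper us ls (vPos cY i j))
    (lower us ls (vPos cZ i j)) (upper us ls (vPos cZ i j))
    (lower us ls (vPos cX i' j')) (upper us ls (vPos cX i' j'))
    (lower us ls (vPos cY i' j')) (upper us ls (vPos cY i' j'))
    (lower us ls (vPos cZ i' j')) (upper us ls (vPos cZ i' j'))
    (lower us ls vL) (lower us ls vH).
  intros x0 x1 y0 y1 z0 z1 x0' x1' y0' y1' z0' z1' l0 h0 Bx By Bz Bx' By' Bz' [BL _] [BH _].
  rewrite !andb_true_iff, !Z.leb_le, Z.ltb_lt.
  intros (((((((((((Hz0 & Hz0') & Hl0) & Hw) & Hc) & Hh0) & Hu) & Hl) & Hr) & Hr') & HU) & HLo).
  apply IZR_le in Hz0, Hz0', Hl0, Hc, Hh0, Hu, Hl, Hr, Hr'; apply IZR_lt in Hw.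
  destruct (P i j) as [x y z], (P i' j') as [x' y' z']; cbn [px py pz] in *.
  apply corners_nonneg_sound with (x := 20 * x) (y := 20 * y) (x' := 20 * x') (y' := 20 * y')
    in HU, HLo; trivial.
  pose proof (far_corner_sound _ _ _ _ _ _ _ _ _ Bx By Hz0 Bz) as HF.
  pose proof (far_corner_sound _ _ _ _ _ _ _ _ _ Bx' By' Hz0' Bz') as HF'.
  revert Hr Hr' HF HF'.
  generalize (far_corner x0 x1 y0 y1 z1) (far_corner x0' x1' y0' y1' z1').
  intros F F' Hr Hr' HF HF'.
  repeat rewrite ?plus_IZR, ?minus_IZR, ?opp_IZR, ?mult_IZR in *.
  set (p := Pt x y z); set (q := Pt x' y' z').
  pose proof (norm_nonneg p) as Np; pose proof (norm_nonneg q) as Nq.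
  assert (Ep : norm p * norm p = x * x + y * y + z * z)
    by (rewrite norm_sqr; unfold p; vring).
  assert (Eq : norm q * norm q = x' * x' + y' * y' + z' * z')
    by (rewrite norm_sqr; unfold q; vring).
  pose proof (rotated_dot_le (IZR pu) (IZR qu) 65 x y z x' y' z') as RU.
  pose proof (rotated_dot_le (IZR pl) (IZR ql) 65 x y z x' y' z') as RL.
  fold p q in RU, RL.
  assert (Ed : dot p q = x * x' + y * y' + z * z') by (unfold p, q; vring).
  unfold good_pair; set (m := norm p) in *; set (n := norm q) in *.
  assert (Hmn : 0 <= m * n) by now apply Rmult_le_pos.
  set (ww := IZR w) in *.
  assert (Hdist : forall k G, 0 <= k -> 400 * (k * k) <= G ->
     1000000 * ((20 - IZR l0) * (20 - IZR l0)) * G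
       <= 36 * 400 * ((ww - 200) * (ww - 200)) * (IZR h0 * IZR h0) ->
     (1 - lam) * k <= 6 * (ww / 1000 - 1/5) * H).
  { intros k G Hk HG HrG.
    assert (Hs : 1000 * (20 - IZR l0) * (20 * k) <= 120 * (ww - 200) * IZR h0).
    { apply sqr_le_le; [apply Rmult_le_pos; lra|].
      replace (1000 * (20 - IZR l0) * (20 * k) * (1000 * (20 - IZR l0) * (20 * k)))
        with (1000000 * ((20 - IZR l0) * (20 - IZR l0)) * (400 * (k * k))) by ring.
      replace (120 * (ww - 200) * IZR h0 * (120 * (ww - 200) * IZR h0))
        with (36 * 400 * ((ww - 200) * (ww - 200)) * (IZR h0 * IZR h0)) by ring.
      eapply Rle_trans; [|exact HrG].
      apply Rmult_le_compat_l; trivial.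
      pose proof (Rle_0_sqr (20 - IZR l0)) as Q; unfold Rsqr in Q; lra. }
    assert ((20 - 20 * lam) * k <= (20 - IZR l0) * k) by (apply Rmult_le_compat_r; lra).
    assert ((ww - 200) * IZR h0 <= (ww - 200) * (20 * H)) by (apply Rmult_le_compat_l; lra).
    lra. }
  assert (Hzz : 400 * (z * z') <= IZR z1 * IZR z1').
  { replace (400 * (z * z')) with ((20 * z) * (20 * z')) by ring.
    apply Rmult_le_compat; lra. }
  assert (Hzz0 : IZR z0 * IZR z0' <= 400 * (z * z')).
  { replace (400 * (z * z')) with ((20 * z) * (20 * z')) by ring.
    apply Rmult_le_compat; lra. }
  exists (ww / 1000).
  split; [lra|]; split; [|split; [|split]].
  - replace (2 * (ww / 1000 * (ww / 1000))) with (ww * ww / 500000) by field; lra.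
  - apply Hdist with (IZR F); [trivial | rewrite Ep; lra | lra].
  - apply Hdist with (IZR F'); [trivial | rewrite Eq; lra | lra].
  - replace (1 - 2 * (ww / 1000 * (ww / 1000))) with ((500000 - ww * ww) / 500000) by field.
    set (c := 500000 - ww * ww) in *.
    assert (Hw2 : ww * ww = 500000 - c) by (unfold c; ring).
    rewrite Ed; apply Rabs_le.
    set (hd := x * x' + y * y') in *; set (hc := x * y' - y * x') in *.
    set (t := z * z') in *.
    (* After multiplication by [c] the rotated bound has the coefficients used in the corner test.
       Adding that test and the bound on [t] yields the claim by linear arithmetic in [hd], [hc],
       [t] and [m * n]. *)
    assert (RU' : c * (IZR pu * hd + IZR qu * hc + 65 * t) <= c * (65 * (m * n)))
      by (apply Rmult_le_compat_l; [|apply RU]; lra).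
    assert (RL' : c * (IZR pl * hd + IZR ql * hc + 65 * t) <= c * (65 * (m * n)))
      by (apply Rmult_le_compat_l; [|apply RL]; lra).
    assert (Tu : ww * ww * (400 * t) <= ww * ww * (IZR z1 * IZR z1'))
      by (apply Rmult_le_compat_l; trivial; apply Rle_0_sqr).
    assert (Tl : (500000 + c) * (IZR z0 * IZR z0') <= (500000 + c) * (400 * t))
      by (apply Rmult_le_compat_l; lra).
    replace (20 * x * (20 * x') + 20 * y * (20 * y')) with (400 * hd) in HU, HLo
      by (unfold hd; ring).
    replace (20 * x * (20 * y') - 20 * y * (20 * x')) with (400 * hc) in HU, HLo
      by (unfold hc; ring).
    rewrite Hw2 in *.
    split; lra.
Qed.

Lemma tree_ok_sound lam H fx fy P t us ls :
  0 <= lam <= 1 -> 1 <= H <= 2 -> 0 <= fx <= 1/2 -> 0 <= fy <= 1/2 ->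
  near_grid lam H fx fy P ->
  Forall (fun c => 20 * value lam H fx fy P (fst c) <= IZR (snd c)) us ->
  Forall (fun c => IZR (snd c) <= 20 * value lam H fx fy P (fst c)) ls ->
  tree_ok us ls t = true ->
  exists i j i' j', good_pair lam H (P i j) (P i' j').
Proof.
  intros HL HH HX HY HP; revert us ls.
  induction t as [x v lo IHlo hi IHhi|i j i' j' w pu qu pl ql]; intros us ls Hus Hls Hok.
  - simpl in Hok; apply andb_true_iff in Hok as [Hlo Hhi].
    destruct (Rle_dec (20 * value lam H fx fy P x) (IZR v)) as [Hx|Hx].
    + apply (IHlo ((x, v) :: us) ls); auto.
    + apply (IHhi us ((x, v) :: ls)); auto.
      constructor; trivial; simpl; lra.
  - exists i, j, i', j'; now apply leaf_ok_sound with (8 := Hok) (fx := fx) (fy := fy).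
Qed.

(** Being a good pair depends on the norms and the inner product only and hence survives
    reflections; this lets the certificate treat one quarter of a cell. *)
Lemma good_pair_mirror lam H (p q p' q' : pt) :
  norm p' = norm p -> norm q' = norm q -> dot p' q' = dot p q ->
  good_pair lam H p' q' -> good_pair lam H p q.
Proof. intros Ep Eq E; unfold good_pair; now rewrite Ep, Eq, E. Qed.

(** * The certificate *)

(* Found by a greedy computer search; [cert_k] covers the range of [lh] starting at [k / 20]. *)
Definition cert_0 : tree :=
  Split vH 26 (Split vH 23 (Split vFy 5 (Split (vPos cZ 1 1) 20 (Leaf 0 (-1) 1 1 513 (-52) 39 (-60)
  25) (Leaf 1 1 0 (-1) 523 (-52) (-39) (-60) (-25))) (Split vFx 5 (Leaf (-1) 0 1 1 513 (-60) (-25)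
  (-63) (-16)) (Split (vPos cZ (-1) 0) 20 (Leaf (-1) 0 1 1 530 (-52) (-39) (-60) (-25)) (Leaf (-1) 0
  1 1 544 (-52) (-39) (-60) (-25))))) (Split vFy 5 (Split (vPos cZ 0 (-1)) 20 (Leaf 0 1 0 (-1) 462
  (-39) 52 (-65) 0) (Leaf 1 1 0 (-1) 494 (-52) (-39) (-60) (-25))) (Split vFx 5 (Split (vPos cZ (-1)
  1) 20 (Leaf 0 (-1) (-1) 1 504 0 (-65) (-52) (-39)) (Leaf (-1) 1 1 0 499 (-63) (-16) (-65) 0))
  (Split vH 25 (Leaf 2 0 0 2 536 (-16) 63 (-39) 52) (Leaf 2 0 0 2 512 (-16) 63 (-52) 39))))) (Split
  vH 32 (Split vH 29 (Split vFy 5 (Split (vPos cZ 0 (-1)) 20 (Split (vPos cZ 0 1) 20 (Split vH 28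
  (Leaf 0 (-1) 0 1 429 (-39) (-52) (-65) 0) (Split (vPos cZ 0 (-1)) 16 (Leaf 0 (-1) 0 1 401 (-52)
  (-39) (-65) 0) (Leaf 0 (-1) 0 1 413 (-39) (-52) (-65) 0))) (Leaf 0 1 0 (-1) 446 (-39) 52 (-65) 0))
  (Split vFy 3 (Leaf 1 1 0 (-1) 473 (-52) (-39) (-60) (-25)) (Leaf 0 (-1) 1 1 466 (-52) 39 (-60)
  25))) (Split vL 1 (Split vFy 8 (Leaf 2 0 0 2 528 0 65 (-39) 52) (Leaf (-1) 2 (-1) (-1) 545 0 65
  (-33) 56)) (Split vH 28 (Split vFy 8 (Leaf 2 0 0 2 514 0 65 (-39) 52) (Leaf (-2) 1 0 (-2) 570 0 65
  (-25) 60)) (Leaf (-2) 1 0 (-2) 551 0 65 (-25) 60)))) (Split vFy 5 (Split (vPos cZ 1 (-2)) 20 (Leaf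
  2 1 1 (-2) 529 16 (-63) (-33) (-56)) (Split vL 1 (Leaf (-2) 0 1 (-2) 548 0 65 (-33) 56) (Split
  (vPos cZ 1 (-2)) 26 (Leaf 1 (-2) 2 1 517 16 63 (-33) 56) (Leaf (-2) 0 1 (-2) 536 0 65 (-33) 56))))
  (Split vL 1 (Leaf (-2) 1 0 (-2) 559 0 65 (-25) 60) (Split (vPos cX (-2) 1) (-45) (Leaf (-2) 1 0
  (-2) 547 0 65 (-25) 60) (Leaf 0 (-2) (-2) 1 540 0 (-65) (-33) (-56)))))) (Split vH 36 (Split vL 1
  (Split vFy 5 (Split vFy 3 (Leaf 2 (-1) 1 2 511 0 65 (-33) 56) (Leaf (-2) 0 1 (-2) 527 0 65 (-25)
  60)) (Split (vPos cY (-2) 1) 13 (Leaf (-2) 1 0 (-2) 533 0 65 (-25) 60) (Leaf (-2) 1 0 (-2) 536 0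
  65 (-25) 60))) (Split vFy 5 (Split vFx 5 (Leaf 3 0 0 3 557 0 65 (-16) 63) (Leaf (-2) 0 1 (-2) 515
  0 65 (-33) 56)) (Split vFy 8 (Leaf (-2) 1 0 (-2) 525 0 65 (-33) 56) (Leaf (-2) 1 0 (-2) 521 0 65
  (-25) 60)))) (Split vL 1 (Split vFy 5 (Leaf 3 (-1) 1 3 559 0 65 (-25) 60) (Leaf (-3) 1 0 (-3) 585
  0 65 (-16) 63)) (Split vFy 5 (Leaf 3 (-1) 1 3 546 0 65 (-25) 60) (Leaf (-3) 1 0 (-3) 570 0 65
  (-16) 63))))).

Definition cert_2 : tree :=
  Split vH 26 (Split vH 23 (Split vFy 5 (Split vH 22 (Split (vPos cY 0 (-1)) (-23) (Leaf 0 (-1) 0 1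
  493 (-39) (-52) (-65) 0) (Leaf 1 1 0 (-1) 504 (-39) (-52) (-63) (-16))) (Leaf 1 1 0 (-1) 480 (-39)
  (-52) (-60) (-25))) (Split vFx 5 (Split (vPos cY (-1) 1) 13 (Leaf (-1) 1 1 0 495 (-63) (-16) (-65)
  0) (Leaf 0 (-1) (-1) 1 516 (-16) (-63) (-56) (-33))) (Split vH 22 (Leaf 2 0 0 2 552 0 65 (-52) 39)
  (Leaf 2 0 0 2 524 0 65 (-52) 39)))) (Split vFy 5 (Split (vPos cZ 0 (-1)) 20 (Split (vPos cX 0 1)
  (-5) (Split vFy 3 (Leaf 0 1 0 (-1) 449 (-16) 63 (-63) 16) (Leaf 0 (-1) 0 1 448 0 (-65) (-63)
  (-16))) (Leaf 0 (-1) 0 1 448 (-60) (-25) (-65) 0)) (Split vFy 3 (Split (vPos cY 1 1) 19 (Leaf 1 1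
  0 (-1) 462 (-39) (-52) (-60) (-25)) (Leaf 1 1 0 (-1) 479 (-52) (-39) (-63) (-16))) (Leaf 0 (-1) 1
  1 470 (-52) 39 (-60) 25))) (Split vFx 5 (Split (vPos cZ (-1) 0) 20 (Split (vPos cY (-1) 0) (-8)
  (Leaf 0 2 (-1) 0 512 (-16) 63 (-52) 39) (Leaf 1 0 (-1) 0 449 (-33) (-56) (-65) 0)) (Split (vPos cY
  (-1) 0) (-8) (Leaf (-1) 0 1 1 470 (-65) 0 (-63) (-16)) (Leaf 1 1 (-1) 0 462 (-60) 25 (-63) 16)))
  (Split vH 25 (Split vH 24 (Leaf 2 0 0 2 513 0 65 (-52) 39) (Leaf 2 0 0 2 503 0 65 (-52) 39)) (Leaf
  2 0 0 2 494 0 65 (-52) 39))))) (Split vH 32 (Split vH 29 (Split vFy 5 (Split vL 3 (Split (vPos cZ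
  0 (-1)) 20 (Split (vPos cZ 0 1) 20 (Split vH 28 (Leaf 0 (-1) 0 1 413 (-39) (-52) (-65) 0) (Split
  (vPos cZ 0 (-1)) 16 (Leaf 0 (-1) 0 1 387 (-39) (-52) (-65) 0) (Leaf 0 (-1) 0 1 398 (-39) (-52)
  (-65) 0))) (Leaf 0 1 0 (-1) 427 (-39) 52 (-65) 0)) (Split vFy 3 (Leaf 1 1 0 (-1) 452 (-52) (-39)
  (-63) (-16)) (Leaf 0 (-1) 1 1 445 (-52) 39 (-63) 16))) (Split vFx 5 (Split vH 28 (Split vFy 3
  (Split (vPos cX 1 2) 18 (Leaf 2 (-1) 1 2 520 16 63 (-33) 56) (Leaf (-2) 1 1 2 535 16 (-63) (-25)
  (-60))) (Leaf 3 0 0 3 584 0 65 (-25) 60)) (Leaf 3 0 0 3 559 16 63 (-25) 60)) (Split (vPos cZ 1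
  (-2)) 20 (Leaf 1 (-2) 2 1 507 16 63 (-39) 52) (Leaf (-2) 0 1 (-2) 538 0 65 (-33) 56)))) (Split vL
  3 (Split vH 28 (Split vFx 5 (Leaf 0 (-2) (-2) 1 549 0 (-65) (-33) (-56)) (Split vFy 8 (Leaf (-2) 0
  1 (-2) 552 0 65 (-25) 60) (Leaf (-2) 1 0 (-2) 557 0 65 (-16) 63))) (Leaf (-2) 1 0 (-2) 538 0 65
  (-33) 56)) (Split vH 28 (Split (vPos cY (-2) 0) (-8) (Leaf 0 3 (-2) 0 564 0 65 (-25) 60) (Split
  (vPos cY 1 (-2)) (-48) (Leaf 1 (-2) (-2) 0 557 0 (-65) (-25) (-60)) (Leaf (-2) 0 1 (-2) 535 0 65
  (-33) 56))) (Split (vPos cY (-2) 0) (-8) (Leaf 0 3 (-2) 0 541 0 65 (-25) 60) (Leaf 1 (-2) (-2) 0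
  534 0 (-65) (-33) (-56)))))) (Split vFy 5 (Split vL 3 (Split vFx 5 (Split vFy 3 (Leaf 0 3 3 0 568
  0 (-65) (-16) (-63)) (Leaf 3 0 0 3 568 0 65 (-16) 63)) (Leaf (-2) 0 1 (-2) 523 0 65 (-33) 56))
  (Split vH 31 (Split vFx 5 (Leaf 3 0 0 3 551 16 63 (-25) 60) (Leaf (-2) 1 0 (-2) 526 0 65 (-33)
  56)) (Leaf 0 3 3 0 534 16 (-63) (-25) (-60)))) (Split vL 3 (Split vH 31 (Split (vPos cY (-2) 0)
  (-8) (Leaf 0 3 (-2) 0 547 0 65 (-25) 60) (Leaf 1 (-2) (-2) 0 540 0 (-65) (-25) (-60))) (Leaf (-2)
  1 0 (-2) 512 0 65 (-33) 56)) (Split (vPos cY (-2) 0) (-8) (Leaf 0 3 (-2) 0 535 0 65 (-25) 60)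
  (Split (vPos cY 1 (-2)) (-48) (Leaf 1 (-2) (-2) 0 529 0 (-65) (-25) (-60)) (Leaf (-2) 0 1 (-2) 510
  0 65 (-33) 56)))))) (Split vH 36 (Split vL 3 (Split vFy 5 (Split vFx 5 (Leaf 3 0 0 3 543 0 65
  (-16) 63) (Leaf 0 3 3 0 546 0 (-65) (-25) (-60))) (Split vH 34 (Leaf (-2) 1 0 (-2) 507 0 65 (-33)
  56) (Leaf (-3) 1 0 (-3) 568 0 65 (-25) 60))) (Split vFy 5 (Split vFx 5 (Leaf 3 0 0 3 528 16 63
  (-25) 60) (Leaf 1 (-3) 3 1 555 0 65 (-25) 60)) (Split vH 34 (Split (vPos cZ (-3) 1) 20 (Leaf (-3)
  1 1 3 550 16 (-63) (-25) (-60)) (Leaf (-3) 1 0 (-3) 571 0 65 (-25) 60)) (Leaf (-3) 1 0 (-3) 552 0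
  65 (-25) 60)))) (Split vFy 5 (Split vL 3 (Leaf 3 (-1) 1 3 533 0 65 (-25) 60) (Leaf 3 (-1) 1 3 519
  16 63 (-33) 56)) (Split vL 3 (Leaf (-3) 1 0 (-3) 555 0 65 (-25) 60) (Leaf (-3) 1 0 (-3) 540 0 65
  (-25) 60))))).

Definition cert_4 : tree :=
  Split vH 26 (Split vH 23 (Split vFy 5 (Split vH 22 (Split vFy 3 (Split (vPos cX 1 1) 15 (Leaf 0
  (-1) 1 1 466 (-33) 56 (-65) 0) (Leaf (-1) 0 1 1 488 (-16) (-63) (-63) (-16))) (Leaf 0 (-1) 1 1 475
  (-33) 56 (-60) 25)) (Split vFy 3 (Split (vPos cX 1 (-1)) 15 (Leaf 1 (-1) 0 1 443 (-39) 52 (-65) 0)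
  (Leaf 1 (-1) (-1) 0 475 0 (-65) (-60) (-25))) (Leaf 0 (-1) 1 1 454 (-33) 56 (-60) 25))) (Split vFx
  5 (Split vL 5 (Split (vPos cY (-1) 1) 13 (Leaf (-1) 1 1 0 467 (-63) (-16) (-63) 16) (Leaf 0 (-1)
  (-1) 1 488 0 (-65) (-56) (-33))) (Split vFx 3 (Leaf 1 1 (-1) 0 454 (-60) 25 (-63) 16) (Leaf (-1) 0
  1 1 462 (-56) (-33) (-63) (-16)))) (Split vL 5 (Split vFy 8 (Leaf 0 2 2 0 524 0 (-65) (-52) (-39))
  (Leaf 2 0 0 2 524 0 65 (-52) 39)) (Split vH 22 (Split vFy 8 (Leaf 0 2 2 0 508 0 (-65) (-52) (-39))
  (Leaf 2 0 0 2 508 0 65 (-52) 39)) (Leaf 2 0 0 2 483 0 65 (-52) 39))))) (Split vFy 5 (Split vH 25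
  (Split vL 5 (Split vH 24 (Split (vPos cX 1 1) 15 (Leaf 0 (-1) 1 1 440 (-39) 52 (-65) 0) (Leaf (-1)
  0 1 1 453 (-39) (-52) (-63) (-16))) (Split vFy 3 (Split (vPos cX 1 (-1)) 15 (Leaf 1 (-1) 0 1 425
  (-39) 52 (-65) 0) (Leaf 1 (-1) (-1) 0 451 (-16) (-63) (-60) (-25))) (Leaf 0 (-1) 1 1 433 (-39) 52
  (-63) 16))) (Split vFy 3 (Split (vPos cX 1 1) 15 (Leaf 0 (-1) 1 1 426 (-39) 52 (-65) 0) (Split vFx
  5 (Leaf 1 1 (-1) 0 442 (-25) 60 (-63) 16) (Leaf (-1) 0 1 1 444 (-39) (-52) (-63) (-16)))) (Split
  vFx 5 (Leaf 1 1 0 (-1) 433 (-25) (-60) (-63) (-16)) (Leaf (-2) 0 1 (-2) 539 16 63 (-33) 56))))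
  (Split vFx 5 (Split vFy 3 (Split vL 5 (Leaf 1 1 0 (-1) 435 (-33) (-56) (-63) (-16)) (Split (vPos
  cY 3 0) (-1) (Leaf 0 3 3 0 559 0 (-65) (-25) (-60)) (Leaf 0 (-3) 3 0 573 16 63 (-25) 60))) (Split
  (vPos cX 0 (-1)) (-3) (Leaf 1 1 0 (-1) 432 (-52) (-39) (-63) (-16)) (Leaf (-1) 1 0 (-1) 449 (-25)
  60 (-60) 25))) (Split (vPos cX 1 2) 13 (Leaf (-2) 0 1 2 535 0 (-65) (-39) (-52)) (Split (vPos cZ 1
  2) 20 (Leaf 2 (-1) 1 2 508 16 63 (-39) 52) (Leaf 1 2 (-1) 0 504 0 65 (-52) 39))))) (Split vL 5
  (Split vFx 5 (Split (vPos cX (-1) 0) (-23) (Leaf (-1) 0 1 0 447 (-25) 60 (-65) 0) (Split vH 25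
  (Leaf 1 1 (-1) 0 436 (-60) 25 (-65) 0) (Leaf 1 1 (-1) 0 420 (-60) 25 (-65) 0))) (Split vH 25 (Leaf
  2 0 0 2 487 0 65 (-52) 39) (Leaf 2 0 0 2 467 0 65 (-52) 39))) (Split vFx 5 (Split (vPos cX (-2) 1)
  (-43) (Split (vPos cY (-2) 1) 13 (Leaf 0 (-2) (-2) 1 541 16 (-63) (-25) (-60)) (Leaf (-2) 1 1 2
  532 16 (-63) (-33) (-56))) (Split vFx 3 (Leaf 1 2 (-2) 1 500 16 63 (-39) 52) (Leaf (-2) 1 1 2 496
  16 (-63) (-39) (-52)))) (Split vH 25 (Split vFy 8 (Leaf 0 2 2 0 476 0 (-65) (-52) (-39)) (Leaf 2 0
  0 2 476 0 65 (-52) 39)) (Leaf 2 0 0 2 456 0 65 (-52) 39)))))) (Split vH 29 (Split vFy 5 (Split vL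
  5 (Split vH 28 (Split vFx 5 (Split vFy 3 (Split (vPos cX 1 2) 18 (Leaf 2 (-1) 1 2 508 16 63 (-33)
  56) (Leaf (-2) 1 1 2 521 16 (-63) (-25) (-60))) (Leaf 3 0 0 3 567 16 63 (-25) 60)) (Split (vPos cY
  1 (-2)) (-43) (Leaf (-2) 0 1 (-2) 521 16 63 (-33) 56) (Leaf 1 (-2) 2 1 483 16 63 (-39) 52)))
  (Split vFx 5 (Leaf 3 0 0 3 543 16 63 (-25) 60) (Leaf (-2) 0 1 (-2) 500 0 65 (-39) 52))) (Split vH
  28 (Split vFx 5 (Split (vPos cX 0 3) (-3) (Leaf 3 0 0 3 549 0 65 (-25) 60) (Split (vPos cY 0 3) 58
  (Leaf 0 3 (-2) 0 511 16 63 (-25) 60) (Leaf (-3) 0 0 3 571 16 (-63) (-16) (-63)))) (Split (vPos cY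
  1 (-2)) (-43) (Leaf (-2) 0 1 (-2) 506 16 63 (-39) 52) (Leaf 2 1 1 (-2) 470 16 (-63) (-39) (-52))))
  (Split vFx 5 (Leaf 3 0 0 3 526 16 63 (-25) 60) (Split (vPos cZ 3 0) 20 (Leaf 3 0 0 (-2) 491 16
  (-63) (-33) (-56)) (Leaf 0 3 3 0 530 16 (-63) (-33) (-56)))))) (Split vL 5 (Split vH 28 (Split
  (vPos cY (-2) 0) (-8) (Leaf 0 3 (-2) 0 549 0 65 (-33) 56) (Split (vPos cY 1 (-2)) (-48) (Leaf 1
  (-2) (-2) 0 542 0 (-65) (-33) (-56)) (Leaf (-2) 0 1 (-2) 520 0 65 (-33) 56))) (Split (vPos cY (-2)
  0) (-8) (Leaf 0 3 (-2) 0 526 0 65 (-33) 56) (Split (vPos cZ 1 (-2)) 20 (Leaf 1 (-2) (-2) 0 504 0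
  (-65) (-33) (-56)) (Leaf 1 (-2) (-2) 0 520 0 (-65) (-33) (-56))))) (Split (vPos cY (-2) 0) (-8)
  (Split (vPos cZ 0 3) 20 (Leaf 0 3 (-2) 0 519 0 65 (-33) 56) (Leaf 0 3 (-2) 0 534 0 65 (-33) 56))
  (Split (vPos cY 1 (-2)) (-48) (Leaf 1 (-2) (-2) 0 528 16 (-63) (-33) (-56)) (Split (vPos cZ (-2)
  0) 20 (Leaf 1 (-2) (-2) 0 498 16 (-63) (-39) (-52)) (Leaf (-2) 0 1 (-2) 506 16 63 (-39) 52))))))
  (Split vH 32 (Split vFy 5 (Split vL 5 (Split vH 31 (Split vFx 5 (Leaf 3 0 0 3 535 16 63 (-25) 60)
  (Split (vPos cZ 3 0) 20 (Leaf 3 0 0 (-2) 495 16 (-63) (-33) (-56)) (Leaf 0 3 3 0 539 0 (-65) (-33)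
  (-56)))) (Leaf 0 3 3 0 519 16 (-63) (-33) (-56))) (Split vH 31 (Split vFx 5 (Leaf 3 0 0 3 518 16
  63 (-25) 60) (Split (vPos cY 1 (-2)) (-43) (Leaf (-2) 0 1 (-2) 480 16 63 (-39) 52) (Leaf 2 1 1
  (-2) 449 16 (-63) (-39) (-52)))) (Leaf 0 3 3 0 503 16 (-63) (-33) (-56)))) (Split vL 5 (Split vH
  31 (Split vFy 8 (Split (vPos cY (-2) 0) (-7) (Leaf 0 3 (-2) 0 519 0 65 (-25) 60) (Leaf 1 (-2) (-2)
  0 505 0 (-65) (-33) (-56))) (Leaf (-2) 1 0 (-2) 501 16 63 (-33) 56)) (Split (vPos cZ (-3) 1) 20
  (Leaf (-3) 1 1 3 545 16 (-63) (-25) (-60)) (Leaf (-3) 1 0 (-3) 562 16 63 (-25) 60))) (Split vH 31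
  (Split vFx 5 (Split (vPos cX (-2) 1) (-43) (Leaf 0 (-2) (-2) 1 480 16 (-63) (-39) (-52)) (Leaf 1 2
  (-2) 1 449 16 63 (-39) 52)) (Split (vPos cY (-2) 0) (-8) (Leaf 0 3 (-2) 0 503 16 63 (-25) 60)
  (Leaf 1 (-2) (-2) 0 491 0 (-65) (-33) (-56)))) (Split (vPos cZ (-3) 1) 20 (Leaf (-3) 1 1 3 529 16
  (-63) (-33) (-56)) (Leaf (-3) 1 0 (-3) 544 16 63 (-33) 56))))) (Split vH 36 (Split vFy 5 (Split vL
  5 (Split vFx 5 (Leaf 3 0 0 3 513 16 63 (-25) 60) (Leaf 1 (-3) 3 1 539 16 63 (-25) 60)) (Split vFx
  5 (Leaf 4 0 0 4 567 16 63 (-16) 63) (Leaf 1 (-3) 3 1 522 16 63 (-33) 56))) (Split vL 5 (Split vFx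
  5 (Leaf (-3) 1 1 3 539 16 (-63) (-25) (-60)) (Leaf 1 (-3) (-3) 0 557 16 (-63) (-25) (-60))) (Split
  vFy 8 (Leaf 1 (-3) (-3) 0 538 16 (-63) (-25) (-60)) (Leaf (-3) 1 0 (-3) 536 16 63 (-25) 60))))
  (Split vFy 5 (Split vFx 5 (Leaf 4 0 0 4 554 16 63 (-16) 63) (Leaf (-3) 1 0 (-3) 533 16 63 (-25)
  60)) (Split (vPos cY (-3) 0) (-8) (Leaf 0 4 (-3) 0 540 0 65 (-25) 60) (Leaf 1 (-3) (-3) 0 533 0
  (-65) (-25) (-60))))))).

Definition cert_6 : tree :=
  Split vH 26 (Split vH 23 (Split (vPos cX 0 2) (-5) (Split vL 7 (Split vH 22 (Split vH 21 (Split
  vFy 5 (Split (vPos cY 0 2) 38 (Leaf 2 0 0 2 509 0 65 (-52) 39) (Leaf 0 2 2 0 517 16 (-63) (-52)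
  (-39))) (Leaf 2 0 0 2 517 (-16) 63 (-56) 33)) (Split vFy 5 (Leaf 0 2 2 0 504 0 (-65) (-52) (-39))
  (Split (vPos cZ 2 0) 20 (Leaf 2 0 0 2 500 (-16) 63 (-56) 33) (Leaf 2 0 0 2 504 (-16) 63 (-56)
  33)))) (Split vFy 5 (Leaf 0 2 2 0 492 0 (-65) (-52) (-39)) (Split (vPos cZ 2 0) 20 (Leaf 2 0 0 2
  486 (-16) 63 (-56) 33) (Leaf 2 0 0 2 492 (-16) 63 (-56) 33)))) (Split vH 22 (Split vFx 5 (Leaf 2 0
  0 2 503 0 65 (-52) 39) (Split vFy 5 (Split (vPos cY 0 2) 38 (Leaf 2 0 0 2 471 16 63 (-52) 39)
  (Leaf 0 2 2 0 503 16 (-63) (-52) (-39))) (Leaf 2 0 0 2 480 0 65 (-56) 33))) (Split vFx 5 (Leaf 2 0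
  0 2 477 0 65 (-52) 39) (Split vFy 5 (Leaf 0 2 2 0 477 16 (-63) (-52) (-39)) (Leaf 2 0 0 2 456 0 65
  (-56) 33))))) (Split (vPos cY (-1) 0) (-5) (Split (vPos cY 0 2) 35 (Split (vPos cX (-1) 0) (-25)
  (Leaf (-1) 0 0 2 480 0 (-65) (-52) (-39)) (Leaf 0 2 (-1) 0 449 (-16) 63 (-60) 25)) (Split vFy 5
  (Leaf 0 2 (-1) 0 514 (-16) 63 (-56) 33) (Leaf 0 2 (-1) 0 489 (-16) 63 (-60) 25))) (Split (vPos cX
  1 1) 15 (Split vFx 5 (Split (vPos cY (-2) 0) (-5) (Split (vPos cX (-2) 0) (-43) (Split vL 7 (Split
  (vPos cY (-2) 0) (-11) (Leaf (-2) 0 0 2 547 0 (-65) (-39) (-52)) (Leaf (-2) 0 0 2 538 0 (-65)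
  (-33) (-56))) (Leaf (-2) 0 0 2 528 0 (-65) (-39) (-52))) (Leaf 0 2 (-2) 0 514 0 65 (-39) 52))
  (Split vH 22 (Split vH 21 (Leaf (-2) 0 1 1 536 (-39) (-52) (-63) (-16)) (Leaf (-2) 0 1 1 522 (-39)
  (-52) (-63) (-16))) (Split (vPos cZ 1 1) 20 (Leaf (-2) 0 1 1 510 (-39) (-52) (-63) (-16)) (Leaf
  (-2) 0 1 1 510 (-39) (-52) (-63) (-16))))) (Split (vPos cX 1 (-1)) 13 (Split (vPos cY 2 0) (-5)
  (Leaf 0 2 2 0 512 0 (-65) (-52) (-39)) (Split (vPos cX 0 (-1)) (-8) (Leaf 2 0 0 (-1) 489 (-25)
  (-60) (-60) (-25)) (Split vFy 5 (Split vFy 3 (Split vL 7 (Leaf 0 (-1) 1 1 426 (-60) 25 (-65) 0)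
  (Split vFy 2 (Leaf 1 1 0 (-1) 413 (-56) (-33) (-65) 0) (Leaf 0 (-1) 1 1 414 (-56) 33 (-65) 0)))
  (Split (vPos cY (-1) 1) 16 (Leaf (-1) 1 1 (-1) 476 (-33) 56 (-60) 25) (Leaf (-1) 1 0 (-1) 498 0 65
  (-56) 33))) (Split (vPos cY (-1) 1) 13 (Split vFy 8 (Leaf (-1) 1 1 (-1) 470 (-25) 60 (-52) 39)
  (Leaf 1 (-1) (-1) 1 470 (-16) (-63) (-52) (-39))) (Leaf (-1) 1 0 (-1) 492 0 65 (-56) 33)))))
  (Split (vPos cZ 1 (-1)) 20 (Leaf 1 (-1) (-1) 0 485 (-33) (-56) (-63) (-16)) (Leaf 1 (-1) (-1) 0
  492 (-33) (-56) (-63) (-16))))) (Split vL 7 (Leaf 1 1 (-1) 0 461 (-25) 60 (-63) 16) (Split (vPos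
  cY 1 1) 15 (Leaf (-1) 0 1 1 445 (-39) (-52) (-65) 0) (Leaf 1 1 (-1) 0 449 0 65 (-60) 25))))))
  (Split vH 25 (Split vFy 5 (Split vL 7 (Split vFy 3 (Split vFx 5 (Split (vPos cY 3 0) (-2) (Leaf 0
  3 3 0 568 0 (-65) (-25) (-60)) (Split (vPos cY 3 0) 2 (Leaf 0 3 3 0 568 16 (-63) (-16) (-63))
  (Leaf 0 (-3) 3 0 582 0 65 (-25) 60))) (Split (vPos cX 1 2) 13 (Leaf (-2) 0 1 2 520 0 (-65) (-39)
  (-52)) (Leaf 1 2 2 (-1) 493 25 (-60) (-39) (-52)))) (Split (vPos cX 1 (-2)) 15 (Leaf 1 (-2) 2 1
  503 0 65 (-39) 52) (Split vFx 5 (Split (vPos cX 0 (-1)) (-3) (Leaf 1 1 0 (-1) 423 (-52) (-39)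
  (-63) (-16)) (Split (vPos cX 0 (-1)) 2 (Leaf 1 1 0 (-1) 423 (-39) (-52) (-63) (-16)) (Leaf (-1) 1
  0 (-1) 440 (-39) 52 (-63) 16))) (Leaf (-2) 0 1 (-2) 522 0 65 (-39) 52)))) (Split (vPos cY 3 0)
  (-3) (Split vFx 5 (Leaf 3 0 0 3 547 0 65 (-33) 56) (Split vFx 8 (Split vFy 3 (Split (vPos cX 0 2)
  (-7) (Leaf 0 2 2 0 466 0 (-65) (-52) (-39)) (Leaf 3 0 0 2 524 0 65 (-33) 56)) (Leaf 1 (-2) (-2) 0
  497 16 (-63) (-39) (-52))) (Leaf (-2) 0 1 (-2) 504 16 63 (-39) 52))) (Split (vPos cY 0 (-3)) (-63)
  (Split (vPos cY 0 (-3)) (-68) (Leaf 0 (-3) 3 0 574 16 63 (-25) 60) (Leaf 0 (-3) 3 0 552 16 63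
  (-33) 56)) (Leaf 3 0 0 (-3) 544 16 (-63) (-33) (-56))))) (Split vL 7 (Split vFx 5 (Split (vPos cX
  (-2) 1) (-43) (Leaf 0 (-2) (-2) 1 522 16 (-63) (-39) (-52)) (Split vFx 3 (Leaf 1 2 (-2) 1 484 25
  60 (-52) 39) (Leaf 1 2 (-2) 1 477 16 63 (-39) 52))) (Split (vPos cX 0 (-2)) (-8) (Leaf 3 0 0 (-2)
  550 16 (-63) (-25) (-60)) (Leaf (-2) 1 0 (-2) 535 16 63 (-33) 56))) (Split vFx 5 (Split vFy 8
  (Split (vPos cX 0 (-2)) (-3) (Leaf (-2) 1 0 (-2) 497 16 63 (-33) 56) (Split (vPos cZ 3 1) 20 (Leaf
  3 1 0 (-2) 551 16 (-63) (-33) (-56)) (Leaf 3 1 0 (-2) 559 16 (-63) (-33) (-56)))) (Leaf 0 (-2)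
  (-2) 1 504 16 (-63) (-39) (-52))) (Split (vPos cX 0 (-2)) (-8) (Leaf 3 0 0 (-2) 531 16 (-63) (-33)
  (-56)) (Leaf (-2) 1 0 (-2) 517 16 63 (-39) 52))))) (Split vFy 5 (Split vL 7 (Split vFx 5 (Split
  (vPos cX 0 3) (-3) (Leaf 3 0 0 3 541 0 65 (-33) 56) (Leaf (-3) 0 0 3 562 16 (-63) (-25) (-60)))
  (Split (vPos cY 1 (-2)) (-43) (Leaf (-2) 0 1 (-2) 498 16 63 (-39) 52) (Leaf 2 1 1 (-2) 463 25
  (-60) (-52) (-39)))) (Split (vPos cY 3 0) (-3) (Split (vPos cZ 0 3) 20 (Split (vPos cZ 3 0) 20
  (Split (vPos cX 0 2) (-5) (Leaf 0 2 2 0 450 16 (-63) (-52) (-39)) (Leaf 3 0 0 2 513 16 63 (-33)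
  56)) (Leaf 3 0 0 3 521 0 65 (-39) 52)) (Leaf 0 3 3 0 525 0 (-65) (-39) (-52))) (Leaf 0 (-3) 3 0
  545 16 63 (-33) 56))) (Split vL 7 (Split (vPos cY (-2) 0) (-8) (Leaf 0 3 (-2) 0 524 16 63 (-39)
  52) (Split (vPos cY 1 (-2)) (-48) (Leaf 1 (-2) (-2) 0 519 16 (-63) (-33) (-56)) (Leaf (-2) 0 1
  (-2) 495 16 63 (-39) 52))) (Split (vPos cX 0 (-2)) (-5) (Split (vPos cX 3 0) 55 (Leaf 0 (-2) 3 0
  487 16 63 (-33) 56) (Leaf 3 0 0 (-2) 525 16 (-63) (-33) (-56))) (Split (vPos cX 0 (-2)) 2 (Leaf
  (-2) 1 0 (-2) 493 0 65 (-39) 52) (Leaf 3 1 0 (-2) 531 16 (-63) (-33) (-56)))))))) (Split vH 29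
  (Split vFy 5 (Split vL 7 (Split vH 28 (Split (vPos cY 3 0) (-3) (Split (vPos cZ 0 3) 20 (Split
  (vPos cZ 3 0) 20 (Split vFx 5 (Leaf 3 0 0 3 519 0 65 (-33) 56) (Split (vPos cY (-2) 0) (-3) (Leaf
  0 3 (-2) 0 523 16 63 (-25) 60) (Leaf 1 3 (-2) 0 541 0 65 (-33) 56))) (Leaf 3 0 0 3 531 0 65 (-39)
  52)) (Leaf 0 3 3 0 535 0 (-65) (-39) (-52))) (Split (vPos cY 3 0) 2 (Leaf 0 3 3 0 535 16 (-63)
  (-25) (-60)) (Leaf 0 (-3) 3 0 555 0 65 (-33) 56))) (Split vFx 5 (Leaf 3 0 0 3 509 16 63 (-33) 56)
  (Split (vPos cZ 3 0) 20 (Leaf 3 0 0 (-2) 477 25 (-60) (-39) (-52)) (Leaf 0 3 3 0 513 16 (-63)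
  (-39) (-52))))) (Split (vPos cY 3 0) (-3) (Split (vPos cX 1 (-3)) 15 (Leaf (-3) 0 1 (-3) 551 16 63
  (-25) 60) (Split vFx 5 (Leaf 3 0 0 3 513 0 65 (-33) 56) (Split (vPos cY (-2) 0) (-3) (Leaf 1 (-3)
  (-2) 0 542 0 (-65) (-25) (-60)) (Leaf 1 3 (-2) 0 523 16 63 (-33) 56)))) (Split (vPos cY 0 (-3))
  (-63) (Leaf 0 (-3) 3 0 536 16 63 (-33) 56) (Leaf 3 0 0 (-3) 510 16 (-63) (-33) (-56))))) (Split vL
  7 (Split (vPos cY (-2) 0) (-8) (Split (vPos cZ 0 3) 20 (Leaf 0 3 (-2) 0 503 16 63 (-39) 52) (Leaf
  0 3 (-2) 0 517 16 63 (-39) 52)) (Split (vPos cY 1 (-2)) (-48) (Leaf 1 (-2) (-2) 0 512 16 (-63)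
  (-33) (-56)) (Split (vPos cZ (-2) 0) 20 (Leaf 1 (-2) (-2) 0 480 16 (-63) (-39) (-52)) (Leaf (-2) 0
  1 (-2) 490 16 63 (-39) 52)))) (Split (vPos cX 0 (-2)) (-5) (Split (vPos cX 3 0) 55 (Leaf 0 (-2) 3
  0 481 16 63 (-33) 56) (Leaf 3 0 0 (-2) 518 16 (-63) (-33) (-56))) (Split (vPos cX 3 1) 55 (Leaf 3
  1 0 (-2) 477 16 (-63) (-39) (-52)) (Leaf 3 1 0 (-2) 523 16 (-63) (-33) (-56)))))) (Split vH 32
  (Split vFy 5 (Split vL 7 (Split (vPos cY 3 0) (-3) (Split vFx 5 (Leaf 3 0 0 3 503 0 65 (-33) 56)
  (Split (vPos cZ 3 0) 20 (Leaf 3 0 0 (-2) 467 25 (-60) (-25) (-60)) (Leaf 0 3 3 0 507 0 (-65) (-39)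
  (-52)))) (Leaf 0 (-3) 3 0 525 16 63 (-33) 56)) (Split vFx 5 (Leaf 4 0 0 4 554 16 63 (-25) 60)
  (Split (vPos cY 3 1) 18 (Leaf 1 (-3) 3 1 510 16 63 (-25) 60) (Leaf 3 1 1 (-2) 484 25 (-60) (-33)
  (-56))))) (Split vL 7 (Split vH 31 (Split vFx 5 (Split (vPos cZ 0 3) 20 (Leaf 0 3 (-2) 0 467 25 60
  (-39) 52) (Leaf 3 0 0 3 505 16 63 (-39) 52)) (Leaf 1 (-3) (-3) 0 546 16 (-63) (-25) (-60))) (Leaf
  1 (-3) (-3) 0 530 16 (-63) (-33) (-56))) (Split vFx 5 (Split (vPos cX 1 3) 18 (Leaf (-3) 1 1 3 510
  16 (-63) (-25) (-60)) (Leaf 1 3 (-2) 1 484 25 60 (-33) 56)) (Leaf 1 (-3) (-3) 0 527 16 (-63) (-25)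
  (-60))))) (Split vFy 5 (Split vH 36 (Split vL 7 (Split (vPos cZ 4 0) 20 (Leaf 4 0 0 (-3) 529 16
  (-63) (-25) (-60)) (Leaf 0 4 4 0 549 16 (-63) (-25) (-60))) (Split (vPos cY 1 (-4)) (-83) (Leaf 1
  (-4) 4 1 551 16 63 (-25) 60) (Leaf 4 1 1 (-4) 536 16 (-63) (-25) (-60)))) (Leaf 0 4 4 0 519 16
  (-63) (-33) (-56))) (Split vH 36 (Split vL 7 (Split (vPos cZ (-3) 1) 20 (Leaf (-3) 1 1 3 501 25
  (-60) (-33) (-56)) (Leaf (-3) 1 0 (-3) 521 16 63 (-33) 56)) (Split (vPos cX 0 (-3)) (-5) (Leaf 4 0
  0 (-3) 528 16 (-63) (-25) (-60)) (Leaf 4 1 0 (-3) 532 0 (-65) (-25) (-60)))) (Split (vPos cY (-1)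
  4) 73 (Leaf (-3) (-1) (-1) 4 510 25 (-60) (-33) (-56)) (Leaf (-1) 4 4 1 523 16 (-63) (-25)
  (-60))))))).

Definition cert_8 : tree :=
  Split vH 26 (Split vH 23 (Split (vPos cX 0 2) (-5) (Split vL 9 (Split vH 22 (Split vFx 5 (Leaf 2 0
  0 2 485 0 65 (-52) 39) (Split vFy 5 (Split (vPos cX 0 2) (-12) (Leaf 0 2 2 0 485 0 (-65) (-52)
  (-39)) (Leaf 3 0 0 2 546 0 65 (-39) 52)) (Leaf 2 0 0 2 464 0 65 (-60) 25))) (Split vFx 5 (Leaf 2 0
  0 2 461 0 65 (-52) 39) (Split vFy 5 (Split (vPos cZ 0 2) 20 (Leaf 0 2 2 0 456 16 (-63) (-52)
  (-39)) (Leaf 0 2 (-1) (-1) 461 25 60 (-56) 33)) (Leaf 2 0 0 2 442 0 65 (-60) 25)))) (Split vH 22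
  (Split vFx 5 (Leaf 2 0 0 2 467 16 63 (-52) 39) (Split vFy 5 (Split (vPos cX 2 0) 33 (Leaf (-1) 0 2
  0 421 (-60) 25 (-65) 0) (Leaf 0 2 2 0 467 0 (-65) (-56) (-33))) (Leaf 2 0 0 2 448 0 65 (-60) 25)))
  (Split vFx 5 (Leaf 2 0 0 2 444 16 63 (-52) 39) (Split vFy 5 (Split (vPos cX 2 0) 33 (Leaf (-1) 0 2
  0 403 (-60) 25 (-65) 0) (Leaf 0 2 2 0 444 0 (-65) (-56) (-33))) (Leaf 2 0 0 2 427 0 65 (-60)
  25))))) (Split (vPos cY (-1) 0) (-5) (Split vFy 5 (Split (vPos cY 0 2) 38 (Leaf (-1) 0 0 2 443
  (-16) (-63) (-60) (-25)) (Leaf 0 2 (-1) 0 480 (-25) 60 (-60) 25)) (Split (vPos cX 0 2) 3 (Split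
  (vPos cY 2 0) (-8) (Leaf 2 0 0 2 493 (-16) 63 (-52) 39) (Split (vPos cX 0 2) (-1) (Split (vPos cX
  3 0) 55 (Leaf 3 0 0 2 515 0 65 (-39) 52) (Split (vPos cX 3 0) 63 (Leaf 3 0 0 2 550 0 65 (-39) 52)
  (Leaf 3 0 0 2 582 0 65 (-33) 56))) (Leaf 0 2 (-1) 0 454 (-25) 60 (-60) 25))) (Leaf 0 2 (-1) 0 458
  (-39) 52 (-63) 16))) (Split (vPos cY (-2) 0) (-5) (Split (vPos cX (-2) 0) (-45) (Split vL 9 (Leaf
  (-2) 0 0 2 531 0 (-65) (-39) (-52)) (Leaf (-2) 0 0 2 509 16 (-63) (-52) (-39))) (Leaf 0 2 (-2) 0
  480 0 65 (-52) 39)) (Split (vPos cX 1 (-1)) 15 (Split vFx 5 (Split (vPos cY (-2) 0) 3 (Leaf (-2) 0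
  1 (-1) 500 (-16) 63 (-56) 33) (Leaf (-2) 0 1 (-1) 503 (-33) 56 (-60) 25)) (Split (vPos cY 1 2) 35
  (Split vH 22 (Split vL 9 (Split (vPos cY 1 (-1)) (-25) (Leaf (-2) 0 1 (-1) 519 0 65 (-39) 52)
  (Leaf 1 2 1 (-1) 440 0 (-65) (-65) 0)) (Leaf 1 2 1 (-1) 422 0 (-65) (-65) 0)) (Split vL 9 (Split
  (vPos cY (-2) 0) 2 (Leaf 1 (-2) (-2) 0 508 0 (-65) (-39) (-52)) (Leaf (-2) 0 1 (-1) 491 (-16) 63
  (-56) 33)) (Leaf 1 2 1 (-1) 404 0 (-65) (-65) 0))) (Split vL 9 (Split (vPos cZ (-2) 0) 20 (Leaf
  (-2) 0 1 2 515 16 (-63) (-39) (-52)) (Leaf (-2) 0 1 2 520 16 (-63) (-39) (-52))) (Leaf (-2) 0 1 2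
  499 16 (-63) (-39) (-52))))) (Split vFx 5 (Split vH 22 (Split vH 21 (Leaf 1 (-1) (-1) 0 472 (-16)
  (-63) (-63) (-16)) (Leaf 1 (-1) (-1) 0 461 (-16) (-63) (-63) (-16))) (Split (vPos cY 1 (-1)) (-25)
  (Leaf 1 (-1) (-1) 0 451 0 (-65) (-60) (-25)) (Leaf 1 (-1) (-1) 0 407 (-25) (-60) (-63) (-16))))
  (Split (vPos cY 1 (-1)) (-25) (Leaf 1 (-1) (-1) 0 463 (-16) (-63) (-56) (-33)) (Leaf (-1) 0 1 (-1)
  437 (-39) 52 (-63) 16))))))) (Split vL 9 (Split vFy 5 (Split (vPos cY 3 0) (-2) (Split (vPos cY 3
  0) (-8) (Split vFx 5 (Leaf 3 0 0 3 527 0 65 (-39) 52) (Split (vPos cY 1 3) 58 (Leaf 3 0 1 3 507 16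
  63 (-16) 63) (Leaf 1 3 3 0 538 16 (-63) (-16) (-63)))) (Leaf 0 3 3 0 532 16 (-63) (-33) (-56)))
  (Split (vPos cY 0 (-3)) (-63) (Leaf 0 (-3) 3 0 551 16 63 (-33) 56) (Leaf 3 0 0 (-3) 523 16 (-63)
  (-33) (-56)))) (Split (vPos cX 0 (-2)) (-5) (Split (vPos cX 3 0) 55 (Leaf 0 (-2) 3 0 493 16 63
  (-33) 56) (Leaf 3 0 0 (-2) 532 16 (-63) (-33) (-56))) (Split (vPos cX 3 1) 55 (Leaf 3 1 0 (-2) 485
  16 (-63) (-39) (-52)) (Leaf 3 1 0 (-2) 538 16 (-63) (-33) (-56))))) (Split vH 25 (Split (vPos cX 0
  (-2)) (-5) (Split vFx 5 (Leaf 3 0 0 (-2) 507 16 (-63) (-39) (-52)) (Split (vPos cZ 3 0) 20 (Leaf 3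
  0 0 (-2) 483 16 (-63) (-39) (-52)) (Leaf 3 0 0 (-2) 489 16 (-63) (-39) (-52)))) (Split (vPos cX 3
  1) 55 (Leaf 3 1 0 (-2) 469 25 (-60) (-39) (-52)) (Split vFy 5 (Split (vPos cZ 3 1) 20 (Leaf 3 1 0
  (-2) 514 16 (-63) (-39) (-52)) (Leaf 3 1 0 (-2) 520 16 (-63) (-39) (-52))) (Leaf 3 1 0 (-2) 513 16
  (-63) (-33) (-56))))) (Split (vPos cY (-2) 0) (-5) (Split vFy 5 (Leaf 0 3 (-2) 0 484 16 63 (-39)
  52) (Leaf 0 3 (-2) 0 467 16 63 (-39) 52)) (Split (vPos cY 1 3) 55 (Leaf 1 3 (-2) 0 449 25 60 (-39)
  52) (Split (vPos cY 1 3) 63 (Leaf 1 3 (-2) 0 474 25 60 (-39) 52) (Leaf 1 3 (-2) 0 496 25 60 (-39)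
  52))))))) (Split vH 29 (Split vL 9 (Split vFy 5 (Split (vPos cY 3 0) (-2) (Split vFx 5 (Leaf 3 0 0
  3 493 16 63 (-39) 52) (Split (vPos cY (-3) 0) (-2) (Leaf (-3) 0 1 (-3) 529 16 63 (-25) 60) (Leaf 1
  4 (-3) 0 572 16 63 (-25) 60))) (Leaf 0 (-3) 3 0 515 16 63 (-33) 56)) (Split (vPos cX 0 (-2)) (-5)
  (Split (vPos cX 3 0) 55 (Leaf 0 (-2) 3 0 464 16 63 (-33) 56) (Leaf 3 0 0 (-2) 498 16 (-63) (-33)
  (-56))) (Split (vPos cX 3 1) 55 (Leaf 3 1 0 (-2) 457 16 (-63) (-39) (-52)) (Leaf 3 1 0 (-2) 503 16
  (-63) (-33) (-56))))) (Split vFy 5 (Split vFx 5 (Leaf 4 0 0 4 538 16 63 (-25) 60) (Split (vPos cX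
  (-3) 1) (-68) (Leaf (-3) 1 0 (-3) 519 16 63 (-33) 56) (Leaf 0 (-3) (-3) 1 493 16 (-63) (-39)
  (-52)))) (Split (vPos cX 0 (-3)) (-5) (Leaf 4 0 0 (-3) 541 16 (-63) (-25) (-60)) (Split (vPos cX 0
  (-3)) 3 (Leaf (-3) 1 0 (-3) 513 0 65 (-33) 56) (Leaf 4 1 0 (-3) 545 16 (-63) (-25) (-60))))))
  (Split vH 32 (Split vFy 5 (Split vL 9 (Split vFx 5 (Leaf 4 0 0 4 530 16 63 (-25) 60) (Leaf 4 0 0
  (-3) 514 16 (-63) (-33) (-56))) (Split (vPos cY (-1) 4) 78 (Leaf (-1) 4 (-3) (-1) 495 25 60 (-33)
  56) (Leaf (-1) 4 4 1 528 25 (-60) (-25) (-60)))) (Split (vPos cX 0 (-3)) (-5) (Leaf 4 0 0 (-3) 537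
  16 (-63) (-25) (-60)) (Split (vPos cX 0 (-3)) 3 (Leaf (-3) 1 0 (-3) 510 0 65 (-33) 56) (Leaf 4 1 0
  (-3) 541 16 (-63) (-25) (-60))))) (Split (vPos cX 0 (-3)) (-5) (Split vL 9 (Split (vPos cY 4 0)
  (-5) (Leaf 4 0 0 (-3) 511 16 (-63) (-16) (-63)) (Leaf 4 0 0 (-3) 507 0 (-65) (-33) (-56))) (Leaf 4
  0 0 (-3) 488 16 (-63) (-33) (-56))) (Split (vPos cX 4 1) 75 (Split (vPos cX 4 1) 68 (Leaf 0 (-3) 4
  1 482 16 63 (-33) 56) (Leaf 4 1 0 (-3) 482 16 (-63) (-33) (-56))) (Split (vPos cY 4 1) 15 (Leaf 4
  1 0 (-3) 512 16 (-63) (-16) (-63)) (Leaf (-1) 4 4 1 533 16 (-63) (-25) (-60))))))).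

Definition cert_10 : tree :=
  Split vH 26 (Split vH 23 (Split vL 12 (Split (vPos cX 0 2) (-5) (Split vL 11 (Split vFx 5 (Leaf 2
  0 0 2 449 16 63 (-56) 33) (Split vFy 5 (Split (vPos cX 0 2) (-13) (Leaf 0 2 2 0 449 0 (-65) (-56)
  (-33)) (Leaf 3 0 0 2 499 0 65 (-52) 39)) (Split vH 22 (Leaf 2 0 0 2 430 0 65 (-60) 25) (Leaf 2 0 0
  2 411 0 65 (-63) 16)))) (Split vFx 5 (Leaf 2 0 0 2 429 16 63 (-56) 33) (Split vFy 5 (Split (vPos
  cX 0 2) (-14) (Leaf 0 2 2 0 429 16 (-63) (-60) (-25)) (Leaf 3 0 0 2 474 0 65 (-52) 39)) (Leaf 2 0
  0 2 413 0 65 (-63) 16)))) (Split (vPos cY (-2) 0) (-5) (Split (vPos cX (-2) 0) (-45) (Leaf (-2) 0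
  0 2 491 16 (-63) (-52) (-39)) (Leaf 0 2 (-2) 0 443 0 65 (-52) 39)) (Split (vPos cY (-2) 0) 4
  (Split (vPos cX 0 2) 4 (Split (vPos cY 0 2) 35 (Split (vPos cY 1 (-1)) (-25) (Split (vPos cY 1
  (-1)) (-34) (Split vFx 5 (Leaf (-2) 0 1 (-1) 457 0 65 (-52) 39) (Leaf (-2) 0 1 (-1) 477 16 63
  (-39) 52)) (Leaf 1 (-1) 0 2 417 (-60) 25 (-65) 0)) (Leaf 1 (-1) 0 2 395 (-60) 25 (-63) 16)) (Leaf
  (-2) 0 0 2 477 16 (-63) (-16) (-63))) (Leaf (-2) 0 0 2 477 0 (-65) (-39) (-52))) (Split (vPos cY 0
  (-3)) (-65) (Split vFx 5 (Leaf 0 (-3) (-2) 0 562 0 (-65) (-33) (-56)) (Leaf 0 (-3) (-2) 0 567 16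
  (-63) (-25) (-60))) (Leaf 0 (-3) (-2) 0 502 16 (-63) (-39) (-52)))))) (Split (vPos cX 0 3) (-5)
  (Split (vPos cX 4 1) 75 (Leaf 4 1 0 3 484 25 60 (-39) 52) (Split vFx 5 (Leaf 4 1 0 3 538 16 63
  (-33) 56) (Leaf 4 1 0 3 523 16 63 (-39) 52))) (Split (vPos cX (-3) 0) (-65) (Leaf (-3) 0 0 3 498
  25 (-60) (-39) (-52)) (Leaf 0 3 (-3) 0 459 25 60 (-52) 39)))) (Split vL 12 (Split vL 11 (Split
  (vPos cX 0 3) (-5) (Split (vPos cX 0 3) (-13) (Split vFy 5 (Split (vPos cX 4 1) 75 (Leaf 4 1 0 3
  509 16 63 (-25) 60) (Leaf 4 1 0 3 561 16 63 (-25) 60)) (Leaf 3 1 0 3 490 25 60 (-33) 56)) (Split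
  vH 25 (Split (vPos cX 3 0) 55 (Leaf 0 3 3 0 477 16 (-63) (-52) (-39)) (Leaf 3 0 0 3 484 0 65 (-39)
  52)) (Leaf 3 0 0 3 462 16 63 (-52) 39))) (Split (vPos cX (-3) 0) (-65) (Leaf (-3) 0 0 3 518 16
  (-63) (-33) (-56)) (Leaf 0 3 (-3) 0 477 25 60 (-39) 52))) (Split (vPos cY (-3) 0) (-5) (Split
  (vPos cX (-3) 0) (-65) (Leaf 1 (-3) (-3) 0 500 25 (-60) (-33) (-56)) (Leaf 0 3 (-3) 0 460 25 60
  (-39) 52)) (Split (vPos cY 1 4) 75 (Leaf (-3) 0 1 4 484 16 (-63) (-39) (-52)) (Leaf 1 4 (-3) 0 529
  16 63 (-33) 56)))) (Split (vPos cX 0 (-4)) (-5) (Leaf 0 (-4) 4 0 516 16 63 (-33) 56) (Split (vPos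
  cY 4 1) 15 (Leaf 0 (-4) 4 1 511 16 63 (-25) 60) (Leaf 4 1 1 (-3) 496 25 (-60) (-39) (-52))))))
  (Split vH 32 (Split vL 12 (Split vFy 5 (Split vL 11 (Split vH 29 (Split vFx 5 (Leaf 4 0 0 4 511 25
  60 (-33) 56) (Split (vPos cZ 0 (-4)) 20 (Leaf 0 (-4) 4 0 522 25 60 (-33) 56) (Leaf 5 0 0 (-4) 556
  16 (-63) (-25) (-60)))) (Leaf 1 (-4) 4 1 505 25 60 (-33) 56)) (Split (vPos cX 0 4) (-5) (Leaf (-4)
  (-1) 0 4 527 16 (-63) (-25) (-60)) (Leaf (-4) 0 0 4 513 16 (-63) (-25) (-60)))) (Split (vPos cX 0
  (-3)) (-5) (Split (vPos cX 0 (-3)) (-14) (Leaf 0 (-3) 3 0 491 16 63 (-33) 56) (Leaf 4 0 0 (-3) 521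
  16 (-63) (-25) (-60))) (Split (vPos cX 4 1) 75 (Leaf 0 (-3) 4 1 485 16 63 (-33) 56) (Leaf 4 1 0
  (-3) 524 16 (-63) (-25) (-60))))) (Split (vPos cX 0 (-4)) (-5) (Leaf (-4) 1 0 (-4) 490 25 60 (-25)
  60) (Leaf (-4) 0 0 (-4) 483 25 60 (-25) 60))) (Split (vPos cY (-4) 0) (-5) (Split (vPos cY 0 5) 95
  (Leaf (-4) 0 0 5 494 16 (-63) (-33) (-56)) (Leaf 0 5 (-4) 0 518 16 63 (-33) 56)) (Split (vPos cY
  (-4) 0) 4 (Leaf 1 (-4) (-4) 0 501 0 (-65) (-33) (-56)) (Leaf 0 (-4) (-4) 0 494 16 (-63) (-25)
  (-60))))).

Definition cert_13 : tree :=
  Split vH 26 (Split vL 15 (Split (vPos cX 0 3) (-5) (Split vL 14 (Split vFy 5 (Leaf (-3) (-1) 0 3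
  481 25 (-60) (-39) (-52)) (Split (vPos cX 0 3) (-15) (Leaf 3 1 0 3 444 33 56 (-39) 52) (Leaf 5 1 0
  3 552 16 63 (-25) 60))) (Leaf 4 1 0 3 462 25 60 (-39) 52)) (Split vH 23 (Split (vPos cX (-3) 0)
  (-65) (Leaf (-3) 0 0 3 467 25 (-60) (-39) (-52)) (Leaf 0 3 (-3) 0 433 33 56 (-52) 39)) (Split
  (vPos cX 0 5) (-5) (Leaf 5 1 0 5 512 25 60 (-25) 60) (Leaf 5 0 0 5 506 25 60 (-25) 60)))) (Leaf 5
  (-1) (-1) (-4) 466 33 (-56) (-39) (-52))) (Split (vPos cX 0 (-5)) (-5) (Leaf (-5) 1 0 (-5) 508 25
  60 (-25) 60) (Leaf (-5) 0 0 (-5) 503 25 60 (-25) 60)).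

(** For [lh >= 4/5] the distance budget is at least [30 (sig - 1/5) H]. Orthogonal index vectors of
    length between 5 and 7 fit into it and tolerate perturbations of a full cell, so no split on
    camera positions is needed. *)
Definition cert_16 : tree :=
  Split vH 26 (Leaf 2 (-5) 5 2 443 33 56 (-39) 52) (Leaf 1 (-6) 6 1 406 33 56 (-33) 56).

Definition certificate : tree :=
  Split vL 8 (Split vL 4 (Split vL 2 cert_0 cert_2) (Split vL 6 cert_4 cert_6)) (Split vL 13 (Split
  vL 10 cert_8 cert_10) (Split vL 16 cert_13 cert_16)).

Lemma certificate_ok : tree_ok nil nil certificate = true.
Proof. vm_compute; reflexivity. Qed.

(** * From a quarter of a cell to all targets *)

Lemma exists_good_pair_quadrant lam H fx fy P :
  0 <= lam <= 1 -> 1 <= H <= 2 -> 0 <= fx <= 1/2 -> 0 <= fy <= 1/2 ->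
  near_grid lam H fx fy P ->
  exists i j i' j', good_pair lam H (P i j) (P i' j').
Proof.
  intros HL HH HX HY HP.
  now apply tree_ok_sound with (8 := certificate_ok) (fx := fx) (fy := fy).
Qed.

Lemma exists_good_pair_half lam H fx fy P :
  0 <= lam <= 1 -> 1 <= H <= 2 -> -1/2 <= fx <= 1/2 -> 0 <= fy <= 1/2 ->
  near_grid lam H fx fy P ->
  exists i j i' j', good_pair lam H (P i j) (P i' j').
Proof.
  intros HL HH HX HY HP.
  destruct (Rle_dec 0 fx) as [F|F].
  { apply exists_good_pair_quadrant with fx fy; trivial; lra. }
  (* Mirroring in [x] requires renaming camera [i] to [- i], which yields again a grid with the same
     perturbation bounds. *)
  destruct (exists_good_pair_quadrant lam H (- fx) fy
    (fun i j => Pt (- px (P (- i)%Z j)) (py (P (- i)%Z j)) (pz (P (- i)%Z j))))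
    as (i & j & i' & j' & G); trivial; try lra.
  - intros i j; destruct (HP (- i)%Z j) as (A & B & C); simpl; repeat split; trivial.
    rewrite opp_IZR in A; rewrite <- Rabs_Ropp; eapply Rle_trans; [|exact A].
    right; f_equal; ring.
  - exists (- i)%Z, j, (- i')%Z, j'; revert G.
    apply good_pair_mirror; [unfold norm; f_equal| unfold norm; f_equal|]; vring.
Qed.

Lemma exists_good_pair lam H fx fy P :
  0 <= lam <= 1 -> 1 <= H <= 2 -> -1/2 <= fx <= 1/2 -> -1/2 <= fy <= 1/2 ->
  near_grid lam H fx fy P ->
  exists i j i' j', good_pair lam H (P i j) (P i' j').
Proof.
  intros HL HH HX HY HP.
  destruct (Rle_dec 0 fy) as [F|F].
  { apply exists_good_pair_half with fx fy; trivial; lra. }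
  destruct (exists_good_pair_half lam H fx (- fy)
    (fun i j => Pt (px (P i (- j)%Z)) (- py (P i (- j)%Z)) (pz (P i (- j)%Z))))
    as (i & j & i' & j' & G); trivial; try lra.
  - intros i j; destruct (HP i (- j)%Z) as (A & B & C); simpl; repeat split; trivial.
    rewrite opp_IZR in B; rewrite <- Rabs_Ropp; eapply Rle_trans; [|exact B].
    right; f_equal; ring.
  - exists i, (- j)%Z, i', (- j')%Z; revert G.
    apply good_pair_mirror; [unfold norm; f_equal| unfold norm; f_equal|]; vring.
Qed.

(** * Assembling the constants *)

Lemma nearest_integer (t : R) : exists n : Z, -1/2 <= t - IZR n <= 1/2.
Proof.
  exists (up (t - 1/2)); destruct (archimed (t - 1/2)); lra.
Qed.

(** The inequality left over once the slack [sig - 1/5] has cancelled. The factor [sig - 1/5 + s2]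
    comes from adding the ball radius to the camera distance, [1 - s2] from the length of the
    hanging segment, and 494/100 is twice the constant 2.47. *)
Lemma aperture_loss (sig s2 ca : R) :
  1/5 < sig -> 2 * (sig * sig) <= 1 -> 0 < s2 <= 199/1000 -> 995/1000 <= ca ->
  6 * (sig - 1/5 + s2) * (1 - s2) <= 494/100 * ca * sig.
Proof.
  intros Hs Hs1 [H0 H1] Hc.
  assert (sig <= 708/1000) by nra.
  apply Rle_trans with (494/100 * (995/1000) * sig); [|nra].
  assert (0 <= (1/5 - s2) * (1 - s2)) by nra.
  (* At [s2 = 1085/6000] the slope [6 * (1 - s2)] in [sig] equals 4.915, just below
     [494/100 * (995/1000)]. Beyond that point [s2 < 1/5] is enough; before it, the largest value of
     [sig] is the critical one. *)
  destruct (Rle_dec 1085 (6000 * s2)); nra.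
Qed.

Theorem theorem5 :
  forall (h alpha lv lh : R) (a b c : Z -> Z -> R),
    0 < h -> 0 < alpha -> alpha <= 1/10 ->
    0 < lv -> lv < 1 -> 0 < lh -> lh < 1 ->
    (forall i j, Rabs (a i j) <= lh * h) ->
    (forall i j, Rabs (b i j) <= lh * h) ->
    (forall i j, Rabs (c i j) <= lv * h) ->
    forall gx gy : R,
      let g := Pt gx gy 0 in
      exists i j i' j' : Z,
        forall E : R,
          eps_le alpha g (plane h) E ->
          eps_le alpha g
            (fun s => s = cam h a b c i j \/ s = cam h a b c i' j')
            (247/100 * ((1 + lv) / (1 - lh)) * E).
Proof.
  intros h alpha lv lh a b c Hh Ha0 Ha1 Hv0 Hv1 Hh0 Hh1 Ha Hb Hc gx gy g.
  destruct (nearest_integer (gx / h)) as [nx Hnx].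
  destruct (nearest_integer (gy / h)) as [ny Hny].
  set (S := fun i j => cam h a b c (nx + i) (ny + j)).
  (* The cameras as seen from the target in units of [h], with indices shifted so that the target is
     within half a cell of the node [(0, 0)]. *)
  set (P := fun i j => pscale (/ h) (psub (S i j) g)).
  assert (Habs : forall x l, Rabs x <= l * h -> Rabs (x / h) <= l).
  { intros x l Hx; unfold Rdiv; rewrite Rabs_mult, (Rabs_right (/ h))
      by (apply Rle_ge, Rlt_le, Rinv_0_lt_compat; trivial).
    apply (Rmult_le_reg_r h); trivial.
    replace (Rabs x * / h * h) with (Rabs x) by (field; lra); trivial. }
  assert (HP : near_grid lh (1 + lv) (gx / h - IZR nx) (gy / h - IZR ny) P).
  { intros i j; unfold P, S, cam, g; cbn [psub pscale px py pz].
    rewrite !plus_IZR; repeat split.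
    - eapply Rle_trans; [|apply (Habs _ _ (Ha (nx + i)%Z (ny + j)%Z))].
      right; f_equal; field; lra.
    - eapply Rle_trans; [|apply (Habs _ _ (Hb (nx + i)%Z (ny + j)%Z))].
      right; f_equal; field; lra.
    - replace (1 + lv - 1) with lv by ring.
      eapply Rle_trans; [|apply (Habs _ _ (Hc (nx + i)%Z (ny + j)%Z))].
      right; f_equal; field; lra. }
  destruct (exists_good_pair lh (1 + lv) (gx / h - IZR nx) (gy / h - IZR ny) P)
    as (i & j & i' & j' & sig & Hsig & Hsig1 & Dp & Dq & Hdot); trivial; try lra.
  exists (nx + i)%Z, (ny + j)%Z, (nx + i')%Z, (ny + j')%Z.
  fold (S i j) (S i' j').
  intros E HE U HU p q Hp Hq.
  apply plane_eps_lower in HE; trivial.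
  destruct (small_angle_bounds alpha Ha0 Ha1) as (Hsa & Hca & [Hs0 Hs1] & _).
  assert (EG : forall k l, psub g (S k l) = pscale (- h) (P k l)).
  { intros k l; unfold P, psub, pscale; cbn [px py pz]; f_equal; field; lra. }
  assert (NG : forall k l, norm (psub g (S k l)) = h * norm (P k l)).
  { intros k l; rewrite EG, <- norm_scale by lra; unfold norm; f_equal; vring. }
  assert (NP : forall k l, 0 < norm (P k l)).
  { intros k l; destruct (HP k l) as (_ & _ & Z).
    apply Rabs_le_bounds in Z.
    destruct (Rle_lt_or_eq_dec 0 _ (norm_nonneg (P k l))) as [|N]; trivial.
    exfalso; pose proof (norm_sqr (P k l)) as Q; rewrite <- N in Q; unfold dot in Q.
    assert (0 < pz (P k l) * pz (P k l)) by nra.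
    pose proof (Rle_0_sqr (px (P k l))); pose proof (Rle_0_sqr (py (P k l))).
    unfold Rsqr in *; lra. }
  (* The largest distance that [good_pair] permits, back in the original unit of length. *)
  set (d := 6 * (sig - 1/5) * (1 + lv) * h / (1 - lh)).
  assert (Ed : d * (1 - lh) = 6 * (sig - 1/5) * (1 + lv) * h) by (unfold d; field; lra).
  assert (HD : forall k l, (1 - lh) * norm (P k l) <= 6 * (sig - 1/5) * (1 + lv) ->
                           0 < norm (psub g (S k l)) <= d).
  { intros k l D; rewrite NG; split; [now apply Rmult_lt_0_compat|].
    apply (Rmult_le_reg_r (1 - lh)); [lra|]; rewrite Ed; nra. }
  destruct (HU (S i j)) as [U1 C1]; auto.
  destruct (HU (S i' j')) as [U2 C2]; auto.
  assert (B : sig * Defs.dist p q * (sig - 1/5)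
              <= 2 * sin alpha * (d * (sig - 1/5 + sin (2 * alpha)))).
  { apply (pair_eps_bound alpha sig d g (S i j) (S i' j') p q (U (S i j)) (U (S i' j')));
      auto.
    rewrite !NG, !EG.
    replace (dot (pscale (- h) (P i j)) (pscale (- h) (P i' j')))
      with (h * h * dot (P i j) (P i' j')) by vring.
    rewrite Rabs_mult, (Rabs_right (h * h)) by nra.
    replace ((1 - 2 * (sig * sig)) * (h * norm (P i j) * (h * norm (P i' j'))))
      with (h * h * ((1 - 2 * (sig * sig)) * (norm (P i j) * norm (P i' j')))) by ring.
    apply Rmult_le_compat_l; [nra | trivial]. }
  assert (Es : sin (2 * alpha) = 2 * sin alpha * cos alpha) by apply sin_2a.
  set (v := sig - 1/5) in *; set (s2 := sin (2 * alpha)) in *; set (sa := sin alpha) in *.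
  set (k := (1 + lv) / (1 - lh)).
  assert (Hk : 0 < k) by (unfold k; apply Rdiv_lt_0_compat; lra).
  assert (Edk : d = 6 * v * h * k) by (unfold d, k; field; lra).
  clearbody k.
  assert (Hv : 0 < v) by (unfold v; lra).
  assert (B1 : sig * Defs.dist p q <= 12 * sa * h * k * (v + s2)).
  { apply (Rmult_le_reg_r v); trivial.
    eapply Rle_trans; [exact B|]; rewrite Edk; right; ring. }
  assert (B2 : 6 * (v + s2) * (1 - s2) <= 494/100 * cos alpha * sig)
    by (unfold v; apply aperture_loss; lra).
  apply (Rmult_le_reg_l sig); [lra|].
  apply (Rmult_le_reg_r (1 - s2)); [lra|].
  apply Rle_trans with (12 * sa * h * k * (v + s2) * (1 - s2)).
  { apply Rmult_le_compat_r; lra. }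
  apply Rle_trans with (2 * sa * h * k * (494/100 * cos alpha * sig)).
  { replace (12 * sa * h * k * (v + s2) * (1 - s2))
      with (2 * sa * h * k * (6 * (v + s2) * (1 - s2))) by ring.
    apply Rmult_le_compat_l; trivial.
    repeat apply Rmult_le_pos; lra. }
  (* The product of sine and cosine recombines into [s2], so the lower bound [2 * h * s2] for
     [E * (1 - s2)] appears with exactly the factor 247/100. *)
  replace (2 * sa * h * k * (494/100 * cos alpha * sig))
    with (247/100 * k * sig * (2 * h * s2)) by (rewrite Es; field).
  replace (sig * (247/100 * k * E) * (1 - s2))
    with (247/100 * k * sig * (E * (1 - s2))) by ring.
  apply Rmult_le_compat_l; trivial.
  repeat apply Rmult_le_pos; lra.
Qed.
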